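(* Let $\mathcal{A}$ be a unital algebra and let $\mathscr{B}$ be a class of Banach spaces stable under finite sums and containing the zero space. Let $e$ be a projection (idempotent) of the matrix algebra $\mathrm{M}_n(\mathcal{A})$ and let $\left(X,\pi,F,\gamma\right)$ be an even Banach Fredholm module over $\mathcal{A}$ with $\pi(1)=\mathrm{Id}_X$, where $X=X_+\oplus X_-$ and $F=\begin{bmatrix} 0 & F_- \\ F_+ & 0 \end{bmatrix}$. Define the bounded operator $e_n:=(\mathrm{Id}\otimes\pi)(e):X^{\oplus n}\to X^{\oplus n}$. Then the bounded operator $$e_n(\mathrm{Id}\otimes F_+)e_n : e_n(X_+^{\oplus n})\to e_n(X_-^{\oplus n})$$ is Fredholm. Moreover, if $X$ belongs to $\mathscr{B}$, its Fredholm index depends only on the class $[e]\in \mathrm{K}_0(\mathcal{A})$ and on the class $[(X,\pi,F,\gamma)]\in\mathrm{K}^0(\mathcal{A},\mathscr{B})$.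
   Context: All algebras and Banach spaces are complex. An even Banach Fredholm module $(X,\pi,F,\gamma)$ over an algebra $\mathcal{A}$ consists of a Banach space $X$, a representation (algebra homomorphism) $\pi:\mathcal{A}\to\mathrm{B}(X)$, a bounded operator $F$ on $X$ with $F^2-\mathrm{Id}_X$ compact and $[F,\pi(a)]$ compact for all $a\in\mathcal{A}$, and a bounded operator $\gamma$ on $X$ with $\gamma^2=\mathrm{Id}_X$, $F\gamma=-\gamma F$ and $[\pi(a),\gamma]=0$ for all $a$. Writing $X_+=\mathrm{Ran}\,\frac{\mathrm{Id}+\gamma}{2}$ and $X_-=\mathrm{Ran}\,\frac{\mathrm{Id}-\gamma}{2}$, one has $X=X_+\oplus X_-$, $\pi(a)=\mathrm{diag}(\pi_+(a),\pi_-(a))$ and $F=\begin{bmatrix} 0 & F_- \\ F_+ & 0 \end{bmatrix}$ with $F_+:X_+\to X_-$, $F_-:X_-\to X_+$. The module is degenerate if $F^2=\mathrm{Id}_X$ and $[F,\pi(a)]=0$ for all $a$. Isomorphism of modules is conjugation of all the operators by a (not necessarily isometric) Banach space isomorphism. Operator homotopy: $X,\pi,\gamma$ fixed, $t\in[0,1]\mapsto F_t$ norm continuous with each $(X,\pi,F_t,\gamma)$ an even Banach Fredholm module. $\mathrm{K}^0(\mathcal{A},\mathscr{B})$ is the abelian group with one generator for each isomorphism class of even Banach Fredholm modules over $\mathcal{A}$ with $X$ in $\mathscr{B}$, subject only to the relations: operator homotopic modules have the same class; the class of a direct sum is the sum of the classes; degenerate modules have class $0$. $\mathrm{K}_0(\mathcal{A})$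 is the Grothendieck group of the abelian semigroup of classes $[e]$ of idempotents of $\mathrm{M}_\infty(\mathcal{A})=\varinjlim \mathrm{M}_n(\mathcal{A})$ (embeddings $x\mapsto\mathrm{diag}(x,0)$), where $e\sim f$ if $e=vw$, $f=wv$ for some $v,w\in\mathrm{M}_\infty(\mathcal{A})$, and $[e]+[f]=[\mathrm{diag}(e,f)]$. *)

(* Defs.v *)
From HB Require Import structures.
From mathcomp Require Import all_boot all_order all_algebra.
From mathcomp Require Import complex.
From mathcomp Require Import boolp classical_sets reals prodnormedzmodule topology normedtype.

Set Implicit Arguments.
Unset Strict Implicit.
Unset Printing Implicit Defensive.

Import Order.TTheory GRing.Theory Num.Theory.
Import numFieldNormedType.Exports ProdNormedZmodule.

Local Open Scope classical_set_scope.
Local Open Scope ring_scope.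

Section ProdComplete.
Context {K : numFieldType} {U V : completeNormedModType K}.

HB.instance Definition _ := Pointed.on (U * V)%type.

Lemma prod_complete (F : set_system (U * V)) :
  ProperFilter F -> cauchy F -> cvg F.
Proof.
move=> FF Fc.
have c1 : cvg (fst @ F).
  apply: cauchy_cvg => A entA.
  rewrite !near_simpl -!near2E !near_map2.
  apply: (Fc [set p | A (p.1.1, p.2.1)]).
  have entB : entourage [set p : (U * V) * (U * V) |
      A (p.1.1, p.2.1) /\ [set: V * V] (p.1.2, p.2.2)].
    exact: prod_entP entA filterT.
  by apply: filterS entB => p [].
have c2 : cvg (snd @ F).
  apply: cauchy_cvg => A entA.
  rewrite !near_simpl -!near2E !near_map2.
  apply: (Fc [set p | A (p.1.2, p.2.2)]).
  have entB : entourage [set p : (U * V) * (U * V) |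
      [set: U * U] (p.1.1, p.2.1) /\ A (p.1.2, p.2.2)].
    exact: prod_entP filterT entA.
  by apply: filterS entB => p [].
apply/cvg_ex; exists (lim (fst @ F), lim (snd @ F)).
have := @cvg_pair _ _ _ F _ _ FF _ _ fst snd c1 c2.
rewrite (_ : (fun x => (x.1, x.2)) = id); last by apply/funext => -[].
exact.
Qed.

HB.instance Definition _ := Uniform_isComplete.Build (U * V)%type prod_complete.

End ProdComplete.

Section Power.
Context {K : numFieldType} (X : completeNormedModType K) (n : nat).

Definition bpow : Type := {ffun 'I_n -> X}.

HB.instance Definition _ := GRing.Lmodule.copy bpow {ffun 'I_n -> X}.

Definition bpow_norm (x : bpow) : K := \sum_i `|(x : {ffun _}) i|.

Let bpow_normD x y : bpow_norm (x + y) <= bpow_norm x + bpow_norm y.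
Proof.
by rewrite -big_split/=; apply: ler_sum => i _; rewrite ffunE ler_normD.
Qed.

Let bpow_normZ k x : bpow_norm (k *: x) = `|k| * bpow_norm x.
Proof. by rewrite mulr_sumr; apply: eq_bigr => i _; rewrite ffunE normrZ. Qed.

Let bpow_norm0 x : bpow_norm x = 0 -> x = 0.
Proof.
move=> /eqP; rewrite psumr_eq0// => /allP x0; apply/ffunP => i.
by rewrite ffunE; apply/eqP; rewrite -normr_eq0; apply: x0; rewrite mem_index_enum.
Qed.

HB.instance Definition _ :=
  Lmodule_isNormed.Build K bpow bpow_normD bpow_normZ bpow_norm0.

Let coord (i : 'I_n) (x : bpow) : X := (x : {ffun 'I_n -> X}) i.

Lemma bpow_complete (F : set_system bpow) :
  ProperFilter F -> cauchy F -> cvg F.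
Proof.
move=> FF Fc.
have cvgi i : cvg (coord i @ F).
  apply: cauchy_cvg; apply/cauchy_ballP => e e0.
  rewrite !near_simpl.
  have /cauchy_ballP /(_ e e0) := Fc.
  apply: filterS => -[x y]; rewrite -!ball_normE /ball_ /=; apply: le_lt_trans.
  rewrite [leRHS]/Num.norm/= /bpow_norm (bigD1 i)//= !ffunE lerDl.
  by apply: sumr_ge0.
apply/cvg_ex; exists ([ffun i => lim (coord i @ F)] : bpow).
apply/cvgrPdist_lt => e e0.
have e1 : 0 < e / n.+1%:R by rewrite divr_gt0// ltr0n.
have : \forall x \near F, forall i, `|lim (coord i @ F) - coord i x| < e / n.+1%:R.
  apply: filter_forall => i; have /cvgrPdist_lt := cvgi i; exact.
apply: filterS => x xP; rewrite /Num.norm/= /bpow_norm.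
apply: (@le_lt_trans _ _ (\sum_(i < n) e / n.+1%:R)).
  by apply: ler_sum => i _; rewrite !ffunE; exact/ltW/xP.
rewrite sumr_const card_ord -[X in X < _]mulr_natr mulrAC ltr_pdivrMr ?ltr0n//.
by rewrite ltr_pM2l// ltr_nat.
Qed.

HB.instance Definition _ := Uniform_isComplete.Build bpow bpow_complete.

End Power.


Section Operators.
Context {K : numFieldType}.
Implicit Types X Y : completeNormedModType K.

Definition bounded_op X Y (f : X -> Y) : Prop :=
  exists M : K, forall x, `|f x| <= M * `|x|.

Definition compact_op X Y (f : X -> Y) : Prop :=
  compact (closure (f @` [set x | `|x| <= 1])).

Definition linear_subspace (V : lmodType K) (D : set V) : Prop :=
  D 0 /\ forall (k : K) x y, D x -> D y -> D (k *: x + y).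

(* The classes of b form a basis of the quotient W / U. *)
Definition quotient_basis (V : lmodType K) (U W : set V) d (b : 'I_d -> V) :=
  (forall i, W (b i)) /\
  forall w, W w -> exists! c : 'rV[K]_d, U (w - \sum_i c 0 i *: b i).

Definition quotient_has_dim (V : lmodType K) (U W : set V) (d : nat) : Prop :=
  exists b : 'I_d -> V, quotient_basis U W b.

(* junk value 0 when W / U is infinite-dimensional *)
Definition quotient_dim (V : lmodType K) (U W : set V) : nat :=
  xget 0%N [set d | quotient_has_dim U W d].

Definition kernel_in (V W : lmodType K) (T : V -> W) (D : set V) : set V :=
  [set x | D x /\ T x = 0].

(* T, defined on V, restricts to a Fredholm operator from the Banach space D
   to the Banach space E. *)
Record fredholm_between X Y (T : X -> Y) (D : set X) (E : set Y) : Prop :=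
  FredholmBetween {
  fredholm_dom : linear_subspace D /\ closed D;
  fredholm_cod : linear_subspace E /\ closed E;
  fredholm_maps : forall x, D x -> E (T x);
  fredholm_linear : forall (k : K) x y, D x -> D y ->
    T (k *: x + y) = k *: T x + T y;
  fredholm_bounded : exists M : K, forall x, D x -> `|T x| <= M * `|x|;
  fredholm_ker : exists d, quotient_has_dim [set 0] (kernel_in T D) d;
  fredholm_coker : exists d, quotient_has_dim (T @` D) E d }.

Definition fredholm_index X Y (T : X -> Y) (D : set X) (E : set Y) : int :=
  (quotient_dim [set 0] (kernel_in T D))%:Z - (quotient_dim (T @` D) E)%:Z.

Definition banach_iso X Y : Prop :=
  exists (u : {linear X -> Y}) (v : {linear Y -> X}),
    [/\ bounded_op u, bounded_op v, cancel u v & cancel v u].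

End Operators.

Section Diagonal.
Context {K : numFieldType} {X Y : completeNormedModType K}.

Definition diag_fun (f : X -> X) (g : Y -> Y) (x : X * Y) : X * Y :=
  (f x.1, g x.2).

Lemma diag_fun_linear (f : {linear X -> X}) (g : {linear Y -> Y}) :
  linear (diag_fun f g).
Proof. by move=> k x y; rewrite /diag_fun/= !linearP. Qed.

HB.instance Definition _ (f : {linear X -> X}) (g : {linear Y -> Y}) :=
  GRing.isLinear.Build K (X * Y)%type (X * Y)%type *:%R (diag_fun f g)
    (diag_fun_linear f g).

Lemma diag_fun_bounded (f : X -> X) (g : Y -> Y) :
  bounded_op f -> bounded_op g -> bounded_op (diag_fun f g).
Proof.
have pos (Z : completeNormedModType K) (h : Z -> Z) (M : K) :
    (forall x, `|h x| <= M * `|x|) -> forall x, `|h x| <= `|M| * `|x|.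
  move=> hM x; rewrite -[X in _ * X]normr_id -normrM ger0_norm//.
  exact: le_trans (normr_ge0 _) (hM x).
move=> [M /pos fM] [N /pos gN]; exists (`|M| + `|N|) => -[x y].
have nc (Z Z' : completeNormedModType K) (z : Z) (z' : Z') : `|z| >=< `|z'|.
  by apply: real_comparable; exact: normr_real.
rewrite !prod_normE/= comparable_ge_max ?nc//; apply/andP; split.
- rewrite (le_trans (fM x))// mulrDl ler_wpDr ?mulr_ge0//.
  + by rewrite comparable_le_max ?nc// normr_ge0.
  + by rewrite ler_wpM2l// comparable_le_max ?nc// lexx.
- rewrite (le_trans (gN y))// mulrDl ler_wpDl ?mulr_ge0//.
  + by rewrite comparable_le_max ?nc// normr_ge0.
  + by rewrite ler_wpM2l// comparable_le_max ?nc// lexx orbT.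
Qed.

Lemma diag_fun_compact (f : X -> X) (g : Y -> Y) :
  compact_op f -> compact_op g -> compact_op (diag_fun f g).
Proof.
move=> cf cg; apply: (subclosed_compact _ (compact_setX cf cg)).
  exact: closed_closure.
have h : diag_fun f g @` [set x | `|x| <= 1] `<=`
    (f @` [set x | `|x| <= 1]) `*` (g @` [set x | `|x| <= 1]).
  move=> z [[x y] /=]; rewrite prod_normE/= comparable_ge_max; last first.
    by apply: real_comparable; exact: normr_real.
  by move=> /andP[x1 y1] <-; split; [exists x|exists y].
move=> p /(closureS h) clp; split => /= B Bp.
- have [|q [[q1 q2]]] := clp (fst @^-1` B); first exact: cvg_fst.
  by exists q.1.
- have [|q [[q1 q2]]] := clp (snd @^-1` B); first exact: cvg_snd.
  by exists q.2.
Qed.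

End Diagonal.

(* Unital associative algebra. The library's algType is not used because it
   excludes the zero algebra. *)
Record unitalAlg (K : pzRingType) := UnitalAlg {
  ualg_ring :> pzRingType;
  ualg_scale : K -> ualg_ring -> ualg_ring;
  ualg_scaleA : forall k l a,
    ualg_scale k (ualg_scale l a) = ualg_scale (k * l) a;
  ualg_scale1 : forall a, ualg_scale 1 a = a;
  ualg_scaleDr : forall k a b,
    ualg_scale k (a + b) = ualg_scale k a + ualg_scale k b;
  ualg_scaleDl : forall k l a,
    ualg_scale (k + l) a = ualg_scale k a + ualg_scale l a;
  ualg_scaleAl : forall k a b, ualg_scale k (a * b) = ualg_scale k a * b;
  ualg_scaleAr : forall k a b, ualg_scale k (a * b) = a * ualg_scale k b }.

Definition unitalAlg_of_algType (K : pzRingType) (A : algType K) :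
  unitalAlg K :=
  UnitalAlg (@scalerA K A) (@scale1r K A) (@scalerDr K A)
    (fun k l a => scalerDl a k l) (@scalerAl K A) (@scalerAr K A).

Section FredholmModules.
Context {R : realType} (A : unitalAlg R[i]).

Record graded_rep := GradedRep {
  gr_space : completeNormedModType R[i];
  gr_rep : A -> {linear gr_space -> gr_space};
  gr_gamma : {linear gr_space -> gr_space};
  gr_rep_bounded : forall a, bounded_op (gr_rep a);
  gr_repD : forall a b x, gr_rep (a + b) x = gr_rep a x + gr_rep b x;
  gr_repZ : forall k a x, gr_rep (ualg_scale k a) x = k *: gr_rep a x;
  gr_repM : forall a b x, gr_rep (a * b) x = gr_rep a (gr_rep b x);
  gr_gamma_bounded : bounded_op gr_gamma;
  gr_gammaK : forall x, gr_gamma (gr_gamma x) = x;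
  gr_rep_gamma : forall a x, gr_rep a (gr_gamma x) = gr_gamma (gr_rep a x) }.

Record fredholm_op (G : graded_rep) := FredholmOp {
  fo_op :> {linear gr_space G -> gr_space G};
  fo_bounded : bounded_op fo_op;
  fo_sqr : compact_op (fun x => fo_op (fo_op x) - x);
  fo_comm : forall a,
    compact_op (fun x => fo_op (gr_rep G a x) - gr_rep G a (fo_op x));
  fo_odd : forall x, fo_op (gr_gamma G x) = - gr_gamma G (fo_op x) }.

Record fredholm_module := FredholmModule {
  fm_base :> graded_rep;
  fm_op : fredholm_op fm_base }.

Definition fm_unital (M : fredholm_module) : Prop :=
  forall x, gr_rep M 1 x = x.

Definition fm_degenerate (M : fredholm_module) : Prop :=
  (forall x, fm_op M (fm_op M x) = x) /\
  (forall a x, fm_op M (gr_rep M a x) = gr_rep M a (fm_op M x)).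

Definition fm_iso (M N : fredholm_module) : Prop :=
  exists (u : {linear gr_space M -> gr_space N})
         (v : {linear gr_space N -> gr_space M}),
    [/\ bounded_op u, bounded_op v, cancel u v & cancel v u] /\
    [/\ forall a x, u (gr_rep M a x) = gr_rep N a (u x),
        forall x, u (fm_op M x) = fm_op N (u x) &
        forall x, u (gr_gamma M x) = gr_gamma N (u x)].

Section DirectSum.
Variables M N : fredholm_module.

Definition fm_sum_rep : graded_rep.
Proof.
refine (@GradedRep (gr_space M * gr_space N)%type
  (fun a => diag_fun (gr_rep M a) (gr_rep N a))
  (diag_fun (gr_gamma M) (gr_gamma N)) _ _ _ _ _ _ _).
- by move=> a; apply: diag_fun_bounded; exact: gr_rep_bounded.
- by move=> a b x; rewrite /= /diag_fun !gr_repD.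
- by move=> k a x; rewrite /= /diag_fun !gr_repZ.
- by move=> a b x; rewrite /= /diag_fun !gr_repM.
- by apply: diag_fun_bounded; exact: gr_gamma_bounded.
- by move=> [x y]; rewrite /= /diag_fun/= !gr_gammaK.
- by move=> a x; rewrite /= /diag_fun/= !gr_rep_gamma.
Defined.

Definition fm_sum_op : fredholm_op fm_sum_rep.
Proof.
refine (@FredholmOp fm_sum_rep (diag_fun (fm_op M) (fm_op N)) _ _ _ _).
- by apply: diag_fun_bounded; exact: fo_bounded.
- have := diag_fun_compact (@fo_sqr _ (fm_op M)) (@fo_sqr _ (fm_op N)).
  by congr compact_op; apply/funext => -[x y].
- move=> a.
  have := diag_fun_compact (@fo_comm _ (fm_op M) a) (@fo_comm _ (fm_op N) a).
  by congr compact_op; apply/funext => -[x y].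
- by move=> x; rewrite /= /diag_fun/= !fo_odd.
Defined.

Definition fm_sum : fredholm_module := FredholmModule fm_sum_op.

End DirectSum.

Definition norm_continuous01 (G : graded_rep) (f : R -> fredholm_op G) : Prop :=
  forall t, 0 <= t <= 1 -> forall eps : R, 0 < eps ->
  exists2 delta : R, 0 < delta & forall s, 0 <= s <= 1 -> `|s - t| < delta ->
    forall x, `|f s x - f t x| <= eps%:C%C * `|x|.

(* Only the values of f on [0, 1] matter. *)
Definition fm_homotopic (M N : fredholm_module) : Prop :=
  exists (G : graded_rep) (f : R -> fredholm_op G),
    [/\ norm_continuous01 f, M = FredholmModule (f 0) &
        N = FredholmModule (f 1)].

(* X_+ = Ran (Id + gamma) / 2 and X_- = Ran (Id - gamma) / 2 *)
Definition even_part (G : graded_rep) : set (gr_space G) :=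
  range (fun x => 2^-1 *: (x + gr_gamma G x)).
Definition odd_part (G : graded_rep) : set (gr_space G) :=
  range (fun x => 2^-1 *: (x - gr_gamma G x)).
Arguments even_part : clear implicits.
Arguments odd_part : clear implicits.

Definition bpow_even (G : graded_rep) n : set (bpow (gr_space G) n) :=
  [set x | forall i, even_part G ((x : {ffun _}) i)].
Definition bpow_odd (G : graded_rep) n : set (bpow (gr_space G) n) :=
  [set x | forall i, odd_part G ((x : {ffun _}) i)].

Arguments bpow_even : clear implicits.
Arguments bpow_odd : clear implicits.

(* e_n = (Id (x) pi)(e), i.e. the operator matrix [pi(e_ij)] on X^n *)
Definition amp_rep (G : graded_rep) n (e : 'M[A]_n)
    (x : bpow (gr_space G) n) : bpow (gr_space G) n :=
  [ffun i => \sum_j gr_rep G (e i j) ((x : {ffun _}) j)].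

(* Id (x) F on X^n *)
Definition amp_op (G : graded_rep) (F : fredholm_op G) n
    (x : bpow (gr_space G) n) : bpow (gr_space G) n :=
  [ffun i => F ((x : {ffun _}) i)].

(* e_n (Id (x) F) e_n, which restricts to e_n (Id (x) F_+) e_n on the even
   part *)
Definition compression (M : fredholm_module) n (e : 'M[A]_n) :=
  amp_rep (G := M) e \o amp_op (fm_op M) (n := n) \o amp_rep (G := M) e.

Definition corner_even (M : fredholm_module) n (e : 'M[A]_n) :=
  amp_rep (G := M) e @` bpow_even M n.
Definition corner_odd (M : fredholm_module) n (e : 'M[A]_n) :=
  amp_rep (G := M) e @` bpow_odd M n.

End FredholmModules.

Arguments even_part {R A} G _.
Arguments odd_part {R A} G _.
Arguments bpow_even {R A} G n _.
Arguments bpow_odd {R A} G n _.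
Arguments amp_rep {R A} G {n} e x.
Arguments amp_op {R A G} F n x.
Arguments compression {R A} M {n} e x.
Arguments corner_even {R A} M {n} e _.
Arguments corner_odd {R A} M {n} e _.

(* The abelian group presented by generators T and relations rel: its elements
   are the classes of abelian group words on T for the least congruence that
   contains rel and the abelian group axioms. *)
Inductive abword (T : Type) : Type :=
| ABgen of T
| ABzero
| ABadd of abword T & abword T
| ABopp of abword T.
Arguments ABzero {T}.

Inductive abeq (T : Type) (rel : abword T -> abword T -> Prop) :
  abword T -> abword T -> Prop :=
| abeq_rel u v : rel u v -> abeq rel u v
| abeq_refl u : abeq rel u u
| abeq_sym u v : abeq rel u v -> abeq rel v u
| abeq_trans u v w : abeq rel u v -> abeq rel v w -> abeq rel u w
| abeq_add u u' v v' :
    abeq rel u u' -> abeq rel v v' -> abeq rel (ABadd u v) (ABadd u' v')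
| abeq_opp u u' : abeq rel u u' -> abeq rel (ABopp u) (ABopp u')
| abeq_addA u v w : abeq rel (ABadd u (ABadd v w)) (ABadd (ABadd u v) w)
| abeq_addC u v : abeq rel (ABadd u v) (ABadd v u)
| abeq_add0 u : abeq rel (ABadd ABzero u) u
| abeq_addN u : abeq rel (ABadd (ABopp u) u) ABzero.

Definition presented_group (T : Type) (rel : abword T -> abword T -> Prop) :=
  {P : abword T -> Prop | exists u, P = abeq rel u}.

Definition presented_class (T : Type) (rel : abword T -> abword T -> Prop)
    (u : abword T) : presented_group rel :=
  exist _ (abeq rel u) (ex_intro _ u erefl).

Section K0Algebra.
Context {A : pzRingType}.

Record idempotent := Idempotent {
  idem_size : nat;
  idem_mx : 'M[A]_idem_size;
  idem_mxP : idem_mx *m idem_mx = idem_mx }.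

(* The embedding x |-> diag(x, 0) of M_n(A) in M_N(A), for n <= N. *)
Definition pad_mx n N (e : 'M[A]_n) : 'M[A]_N :=
  \matrix_(i, j) match insub (i : nat), insub (j : nat) with
                 | Some i', Some j' => e i' j'
                 | _, _ => 0
                 end.

(* e = v w and f = w v in the direct limit of the M_N(A) *)
Definition idem_equiv (e f : idempotent) : Prop :=
  exists N, [/\ (idem_size e <= N)%N, (idem_size f <= N)%N &
    exists v w : 'M[A]_N,
      pad_mx N (idem_mx e) = v *m w /\ pad_mx N (idem_mx f) = w *m v].

Lemma idem_diag_proof (e f : idempotent) :
  block_mx (idem_mx e) 0 0 (idem_mx f) *m block_mx (idem_mx e) 0 0 (idem_mx f)
  = block_mx (idem_mx e) 0 0 (idem_mx f).
Proof.
by rewrite mulmx_block !mulmx0 !mul0mx !addr0 !add0r !idem_mxP.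
Qed.

Definition idem_diag (e f : idempotent) : idempotent :=
  Idempotent (idem_diag_proof e f).

(* Presentation of the Grothendieck group of the semigroup of classes. *)
Inductive K0_rel : abword idempotent -> abword idempotent -> Prop :=
| K0_rel_equiv e f : idem_equiv e f -> K0_rel (ABgen e) (ABgen f)
| K0_rel_diag e f :
    K0_rel (ABgen (idem_diag e f)) (ABadd (ABgen e) (ABgen f)).

Definition K0_class (e : idempotent) : presented_group K0_rel :=
  presented_class K0_rel (ABgen e).

End K0Algebra.

Section KHomology.
Context {R : realType} (A : unitalAlg R[i]).
Variable BB : completeNormedModType R[i] -> Prop.

Record module_in := ModuleIn {
  mi_module :> fredholm_module A;
  mi_space : BB (gr_space mi_module) }.

(* Relating M to M1 + M2 when M is isomorphic to the direct sum avoids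
   choosing a norm on the direct sum. *)
Inductive KH_rel : abword module_in -> abword module_in -> Prop :=
| KH_rel_iso (M N : module_in) : fm_iso M N -> KH_rel (ABgen M) (ABgen N)
| KH_rel_homotopy (M N : module_in) : fm_homotopic M N ->
    KH_rel (ABgen M) (ABgen N)
| KH_rel_sum (M M1 M2 : module_in) : fm_iso M (fm_sum M1 M2) ->
    KH_rel (ABgen M) (ABadd (ABgen M1) (ABgen M2))
| KH_rel_degenerate (M : module_in) : fm_degenerate M ->
    KH_rel (ABgen M) ABzero.

Definition KH_class (M : module_in) : presented_group KH_rel :=
  presented_class KH_rel (ABgen M).

End KHomology.

Section BanachClass.
Context {K : numFieldType}.
Variable BB : completeNormedModType K -> Prop.

(* Direct sums of Banach spaces are taken up to isomorphism, so that for
   instance Hilbert spaces qualify. *)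
Definition sum_stable : Prop := forall X Y, BB X -> BB Y ->
  exists Z : completeNormedModType K, BB Z /\ banach_iso Z (X * Y)%type.

Definition has_zero_space : Prop :=
  exists Z : completeNormedModType K, BB Z /\ forall x : Z, x = 0.

End BanachClass.

(* Main.v *)
Require Import Defs.
From HB Require Import structures.
From mathcomp Require Import all_boot all_order all_algebra.
From mathcomp Require Import complex.
From mathcomp Require Import boolp classical_sets reals topology normedtype.
From mathcomp Require Import ring lra zify.

Set Implicit Arguments.
Unset Strict Implicit.
Unset Printing Implicit Defensive.

Import Order.TTheory GRing.Theory Num.Theory.
Import numFieldNormedType.Exports.

Local Open Scope classical_set_scope.
Local Open Scope ring_scope.

(** The theorem rests on one principle: if S is a parametrix of T, that is, if
   ST and TS are compact perturbations of the identity, then T is Fredholm and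
   ind T = - ind S. Hence two operators with a common parametrix have the same
   index, and their difference need not be examined.

   The analytic input is therefore Riesz theory. For k compact, 1 + k has
   kernel and cokernel of the same finite dimension
   ([index_one_plus_compact]): its kernel is finite-dimensional because a
   compact ball is covered by finitely many small balls, the powers of 1 + k
   have finite ascent and descent by Riesz's lemma, and beyond them the
   cokernel is read off on the finite-dimensional space ker (1 + k)^m. A
   summand of norm at most 1/2 is absorbed by a Neumann-type inverse
   ([index_one_plus_small_compact]). The algebraic input is the additivity of
   the index under composition ([has_dims_comp]), proved by counting
   dimensions of quotients.

   Since F commutes with e_n modulo compact operators and F^2 = 1 modulo
   compact operators, e_n F e_n is its own parametrix between the two corners
   e_n (X_+^n) and e_n (X_-^n). Let e = v w and f = w v, with rectangular
   matrices, and let F' be close to F. Then v F' w is conjugate to the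
   compression of F' by f, and it agrees with e_n F modulo a compact and a small
   operator, so that it shares the parametrix e_n F e_n. This is
   [index_compress]. With F' = F it shows that the index depends on the
   equivalence class of the idempotent only; with v = w = e it shows that the
   index is locally constant along an operator homotopy. Isomorphisms, direct
   sums, degenerate modules and block diagonal idempotents are treated
   directly. The index thus respects the defining relations of both groups, and
   it extends to words in the generators, which gives the dependence on the two
   classes alone. *)

(** * Dimensions of quotient spaces *)

Section Quotients.
Context {K : numFieldType}.
Implicit Types V : lmodType K.

Definition linear_on V V' (W : set V) (f : V -> V') : Prop :=
  forall (k : K) x y, W x -> W y -> f (k *: x + y) = k *: f x + f y.

Section LinearOn.
Context {V V' : lmodType K} (W : set V) (f : V -> V').
Hypotheses (sW : linear_subspace W) (lf : linear_on W f).

Lemma subspace0 : W 0. Proof. by case: sW. Qed.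

Lemma subspaceD x y : W x -> W y -> W (x + y).
Proof. by move=> Wx Wy; rewrite -[x]scale1r; case: sW => _; apply. Qed.

Lemma subspaceZ k x : W x -> W (k *: x).
Proof. by move=> Wx; rewrite -[_ *: _]addr0; case: sW => W0; apply. Qed.

Lemma subspaceN x : W x -> W (- x).
Proof. by rewrite -scaleN1r; exact: subspaceZ. Qed.

Lemma subspaceB x y : W x -> W y -> W (x - y).
Proof. by move=> Wx /subspaceN; exact: subspaceD. Qed.

Lemma subspace_sum (I : Type) (r : seq I) (P : pred I) (x : I -> V) :
  (forall i, W (x i)) -> W (\sum_(i <- r | P i) x i).
Proof.
by move=> Wx; elim/big_ind: _ => //; [exact: subspace0|exact: subspaceD].
Qed.

Lemma linear_onD x y : W x -> W y -> f (x + y) = f x + f y.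
Proof. by move=> Wx Wy; rewrite -[x]scale1r lf// !scale1r. Qed.

Lemma linear_on0 : f 0 = 0.
Proof.
by apply: (addrI (f 0)); rewrite -linear_onD ?addr0//; exact: subspace0.
Qed.

Lemma linear_onZ k x : W x -> f (k *: x) = k *: f x.
Proof.
by move=> Wx; rewrite -[k *: x]addr0 lf ?linear_on0 ?addr0//; exact: subspace0.
Qed.

Lemma linear_onN x : W x -> f (- x) = - f x.
Proof. by move=> Wx; rewrite -scaleN1r linear_onZ ?scaleN1r. Qed.

Lemma linear_onB x y : W x -> W y -> f (x - y) = f x - f y.
Proof.
by move=> Wx Wy; rewrite linear_onD ?linear_onN//; exact: subspaceN.
Qed.

Lemma linear_on_sum n (x : 'I_n -> V) (c : 'I_n -> K) :
  (forall i, W (x i)) -> f (\sum_i c i *: x i) = \sum_i c i *: f (x i).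
Proof.
move=> Wx; pose Q v w := W v /\ f v = w.
suff [] : Q (\sum_i c i *: x i) (\sum_i c i *: f (x i)) by [].
apply: (big_ind2 Q) => [|v w v' w' [Wv <-] [Wv' <-]|i _].
- by split; [exact: subspace0|exact: linear_on0].
- by split; [exact: subspaceD|exact: linear_onD].
- by split; [exact: subspaceZ|exact: linear_onZ].
Qed.

End LinearOn.

(** The isomorphism of W / U with the d-dimensional row space that a basis
   of the quotient defines. *)
Definition quotient_coord V (U W : set V) d (phi : V -> 'rV[K]_d) : Prop :=
  [/\ linear_on W phi, forall w, W w -> (phi w = 0 <-> U w) &
      forall c, exists2 w, W w & phi w = c].

Lemma quotient_coordP V (U W : set V) d :
  linear_subspace U -> linear_subspace W -> U `<=` W ->
  quotient_has_dim U W d <-> exists phi, quotient_coord U W (d := d) phi.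
Proof.
move=> sU sW UW; split=> [[b [Wb bP]]|[phi [lphi kphi sphi]]].
  have Wsum (c : 'rV[K]_d) : W (\sum_i c 0 i *: b i).
    by apply: subspace_sum => // i; exact: subspaceZ.
  have /choice[phi phiP] (w : V) :
      exists c : 'rV[K]_d, W w -> U (w - \sum_i c 0 i *: b i).
    have [Ww|nWw] := pselect (W w); last by exists 0.
    by have [c [Uc _]] := bP w Ww; exists c.
  have phi_uniq w (c : 'rV[K]_d) : W w -> U (w - \sum_i c 0 i *: b i) -> phi w = c.
    move=> Ww Uc; have [c' [_ cu]] := bP w Ww.
    by rewrite -(cu _ (phiP _ Ww)) -(cu _ Uc).
  exists phi; split=> [k x y Wx Wy|w Ww|c].
  - apply: phi_uniq; first by apply: subspaceD => //; exact: subspaceZ.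
    have -> : k *: x + y - \sum_i (k *: phi x + phi y) 0 i *: b i =
      k *: (x - \sum_i phi x 0 i *: b i) + (y - \sum_i phi y 0 i *: b i).
      rewrite scalerBr addrACA -opprD scaler_sumr -big_split/=.
      congr (_ - _); apply: eq_bigr => i _.
      by rewrite !mxE scalerDl scalerA.
    by apply: subspaceD (phiP _ Wy) => //; apply: subspaceZ (phiP _ Wx).
  - have sum0 : \sum_i (0 : 'rV[K]_d) 0 i *: b i = 0.
      by apply: big1 => i _; rewrite mxE scale0r.
    split=> [phi0|Uw]; first by have := phiP _ Ww; rewrite phi0 sum0 subr0.
    by apply: phi_uniq => //; rewrite sum0 subr0.
  - exists (\sum_i c 0 i *: b i) => //.
    by apply: phi_uniq => //; rewrite subrr; exact: subspace0.
have /choice[b bP] (i : 'I_d) : exists w, W w /\ phi w = delta_mx 0 i.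
  by have [w] := sphi (delta_mx 0 i); exists w.
have Wb i : W (b i) by case: (bP i).
have Wsum (c : 'rV[K]_d) : W (\sum_i c 0 i *: b i).
  by apply: subspace_sum => // i; exact: subspaceZ.
have phib (c : 'rV[K]_d) : phi (\sum_i c 0 i *: b i) = c.
  rewrite (linear_on_sum sW lphi)// [RHS]row_sum_delta.
  by apply: eq_bigr => i _; case: (bP i) => _ ->.
exists b; split=> // w Ww; exists (phi w); split=> [|c Uc].
  apply/kphi; first exact: subspaceB.
  by rewrite (linear_onB sW lphi)// phib subrr.
have Wc : W (w - \sum_i c 0 i *: b i) by exact: subspaceB.
have := (kphi _ Wc).2 Uc; rewrite (linear_onB sW lphi)// phib.
by move/eqP; rewrite subr_eq0 => /eqP.
Qed.

Lemma quotient_coord_le V (U W : set V) d d' phi psi : linear_subspace W ->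
  quotient_coord U W (d := d) phi -> quotient_coord U W (d := d') psi ->
  (d <= d')%N.
Proof.
move=> sW [lphi kphi sphi] [lpsi kpsi spsi].
have /choice[b bP] (i : 'I_d) : exists w, W w /\ phi w = delta_mx 0 i.
  by have [w] := sphi (delta_mx 0 i); exists w.
have /choice[b' bP'] (i : 'I_d') : exists w, W w /\ psi w = delta_mx 0 i.
  by have [w] := spsi (delta_mx 0 i); exists w.
have Wb i : W (b i) by case: (bP i).
have Wb' i : W (b' i) by case: (bP' i).
apply: (@mulmx1_min _ _ _ (\matrix_i psi (b i)) (\matrix_j phi (b' j))).
apply/row_matrixP => i; rewrite row_mul rowK row1.
have Ws : W (\sum_j psi (b i) 0 j *: b' j).
  by apply: subspace_sum => // j; exact: subspaceZ.
have psis : psi (\sum_j psi (b i) 0 j *: b' j) = psi (b i).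
  rewrite (linear_on_sum sW lpsi)// [RHS]row_sum_delta.
  by apply: eq_bigr => j _; case: (bP' j) => _ ->.
have : psi (b i - \sum_j psi (b i) 0 j *: b' j) = 0.
  by rewrite (linear_onB sW lpsi)// psis subrr.
move=> /(kpsi _ (subspaceB sW (Wb i) Ws)) /(kphi _ (subspaceB sW (Wb i) Ws)).
rewrite (linear_onB sW lphi)// (linear_on_sum sW lphi)//.
move=> /eqP; rewrite subr_eq0 => /eqP.
have [_ <-] := bP i => ->.
rewrite mulmx_sum_row; apply: eq_bigr => j _; congr (_ *: _).
by rewrite rowK.
Qed.

Lemma quotient_has_dim_uniq V (U W : set V) d d' :
  linear_subspace U -> linear_subspace W -> U `<=` W ->
  quotient_has_dim U W d -> quotient_has_dim U W d' -> d = d'.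
Proof.
move=> sU sW UW /quotient_coordP[]// phi Hphi /quotient_coordP[]// psi Hpsi.
by apply/eqP; rewrite eqn_leq; apply/andP; split; apply: quotient_coord_le;
  eauto.
Qed.

Lemma quotient_dimE V (U W : set V) d :
  linear_subspace U -> linear_subspace W -> U `<=` W ->
  quotient_has_dim U W d -> quotient_dim U W = d.
Proof.
move=> sU sW UW Hd; apply: xget_unique => //= d' Hd'.
exact: (quotient_has_dim_uniq sU sW UW).
Qed.

(** Coordinates on W' / U' pull back along f, and coordinates on W / U pull back
   along any choice of preimages modulo U'. The second and third isomorphism
   theorems and all identifications of kernels and cokernels are instances. *)
Lemma quotient_has_dim_map V V' (U W : set V) (U' W' : set V') f d :
  linear_subspace U -> linear_subspace W -> U `<=` W ->
  linear_subspace U' -> linear_subspace W' -> U' `<=` W' ->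
  linear_on W f -> (forall w, W w -> W' (f w)) ->
  (forall w, W w -> (U' (f w) <-> U w)) ->
  (forall w', W' w' -> exists2 w, W w & U' (w' - f w)) ->
  quotient_has_dim U W d <-> quotient_has_dim U' W' d.
Proof.
move=> sU sW UW sU' sW' UW' lf fW fU fs; rewrite !quotient_coordP//; split.
  move=> [phi [lphi kphi sphi]].
  have /choice[g gP] w' : exists w, W' w' -> W w /\ U' (w' - f w).
    have [/fs[w Ww Uw]|] := pselect (W' w'); first by exists w.
    by exists 0.
  have phig w' w : W' w' -> W w -> U' (w' - f w) -> phi (g w') = phi w.
    move=> Ww' Ww Uw; have [Wg Ug] := gP _ Ww'.
    apply/eqP; rewrite -subr_eq0 -(linear_onB sW lphi)//; apply/eqP/kphi.
      exact: subspaceB.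
    apply/fU; first exact: subspaceB.
    rewrite (linear_onB sW lf)//.
    have -> : f (g w') - f w = (w' - f w) - (w' - f (g w')).
      by rewrite opprB [RHS]addrC addrA addrNK.
    exact: subspaceB.
  exists (phi \o g); split=> [k x y Wx Wy|w' Ww'|c] /=.
  - have [Wgx Ugx] := gP _ Wx; have [Wgy Ugy] := gP _ Wy.
    rewrite -lphi//; apply: phig.
    + by apply: subspaceD => //; exact: subspaceZ.
    + by apply: subspaceD => //; exact: subspaceZ.
    + rewrite lf//.
      have -> : k *: x + y - (k *: f (g x) + f (g y)) =
         k *: (x - f (g x)) + (y - f (g y)) by rewrite scalerBr addrACA -opprD.
      by apply: subspaceD => //; exact: subspaceZ.
  - have [Wg Ug] := gP _ Ww'; rewrite kphi// -fU//; split=> Uh.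
      by rewrite -[w'](subrK (f (g w'))); exact: subspaceD.
    by rewrite -[f _](subKr w'); exact: subspaceB.
  - have [w Ww <-] := sphi c; exists (f w); first exact: fW.
    by apply: phig => //; [exact: fW|rewrite subrr; exact: subspace0].
move=> [phi [lphi kphi sphi]]; exists (phi \o f).
split=> [k x y Wx Wy|w Ww|c] /=.
- by rewrite lf// lphi//; exact: fW.
- by rewrite kphi ?fU//; exact: fW.
- have [w' Ww' <-] := sphi c; have [w Ww Uw] := fs _ Ww'; exists w => //.
  apply/eqP; rewrite -subr_eq0 -(linear_onB sW' lphi)//; last exact: fW.
  apply/eqP/kphi; first by apply: subspaceB => //; exact: fW.
  by rewrite -opprB; exact: subspaceN.
Qed.

Lemma quotient_has_dimD V (U W Z : set V) a b :
  linear_subspace U -> linear_subspace W -> linear_subspace Z ->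
  U `<=` W -> W `<=` Z ->
  quotient_has_dim U W a -> quotient_has_dim W Z b ->
  quotient_has_dim U Z (a + b).
Proof.
move=> sU sW sZ UW WZ /quotient_coordP[]// phi [lphi kphi sphi].
move=> [c [Zc cP]].
have : exists psi, quotient_coord W Z (d := b) psi.
  by apply/quotient_coordP => //; exists c; split.
move=> [psi [lpsi kpsi spsi]].
have {cP c Zc} [s [ls Zs psis]] : exists s : 'rV[K]_b -> V,
    [/\ linear s, forall c, Z (s c) & forall c, psi (s c) = c].
  have /choice[h hP] (i : 'I_b) : exists w, Z w /\ psi w = delta_mx 0 i.
    by have [w] := spsi (delta_mx 0 i); exists w.
  have Zh i : Z (h i) by case: (hP i).
  exists (fun c => \sum_i c 0 i *: h i); split=> [k x y|d|d].
  - rewrite scaler_sumr -big_split/=; apply: eq_bigr => i _.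
    by rewrite !mxE scalerDl scalerA.
  - by apply: subspace_sum => // i; exact: subspaceZ.
  - rewrite (linear_on_sum sZ lpsi)// [RHS]row_sum_delta.
    by apply: eq_bigr => j _; case: (hP j) => _ ->.
have Zr z : Z z -> W (z - s (psi z)).
  move=> Zz; apply/kpsi; first exact: subspaceB.
  by rewrite (linear_onB sZ lpsi)// psis subrr.
have s0 : s 0 = 0.
  by apply: (addrI (s 0)); rewrite -{1}[s 0]scale1r -ls scale1r !addr0.
apply/quotient_coordP => //; first exact: subset_trans WZ.
exists (fun z => row_mx (phi (z - s (psi z))) (psi z)).
split=> [k x y Zx Zy|z Zz|c].
- rewrite scale_row_mx add_row_mx lpsi// ls; congr row_mx.
  by rewrite -lphi; [|exact: Zr|exact: Zr];
    rewrite scalerBr addrACA -opprD.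
- split.
    rewrite -row_mx0 => /eq_row_mx[p0 q0].
    by have := (kphi _ (Zr _ Zz)).1 p0; rewrite q0 s0 subr0.
  move=> Uz; have q0 : psi z = 0 by apply/kpsi => //; exact: UW.
  rewrite q0 s0 subr0 (_ : phi z = 0) ?row_mx0//.
  by apply/kphi => //; exact: UW.
- have [w Ww pw] := sphi (lsubmx c).
  have psiw : psi (w + s (rsubmx c)) = rsubmx c.
    rewrite (linear_onD lpsi) ?psis//; last exact: WZ.
    by rewrite (_ : psi w = 0) ?add0r//; apply/kpsi => //; exact: WZ.
  exists (w + s (rsubmx c)); first by apply: subspaceD => //; exact: WZ.
  by rewrite psiw addrK pw hsubmxK.
Qed.

(** A matrix of maximal rank among those with rows in S has S as row space. *)
Lemma subspace_rowspace d (S : set 'rV[K]_d) : linear_subspace S ->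
  exists r (B : 'M[K]_(r, d)), row_free B /\ forall c, S c <-> (c <= B)%MS.
Proof.
move=> sS; pose P r := `[< exists A : 'M[K]_d,
   (forall c, (c <= A)%MS -> S c) /\ \rank A = r >].
have P0 : exists r, P r.
  exists 0%N; apply/asboolP; exists 0; rewrite mxrank0; split=> // c.
  by rewrite submx0 => /eqP ->; exact: subspace0.
have Pd r : P r -> (r <= d)%N by move=> /asboolP[A [_ <-]]; exact: rank_leq_row.
case: (ex_maxnP P0 Pd) => r /asboolP[A [AS rA]] rmax.
exists (\rank A), (row_base A); split; first exact: row_base_free.
move=> c; rewrite (eq_row_base A); split=> [Sc|]; last exact: AS.
have : P (\rank (A + c)%MS).
  apply/asboolP; exists (A + c)%MS; split=> // x /sub_addsmxP[[u v]/= ->].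
  apply: subspaceD => //; first by apply: AS; exact: submxMl.
  by rewrite [v]mx11_scalar mul_scalar_mx; exact: subspaceZ.
move=> /rmax; rewrite -rA => rle.
apply: submx_trans (addsmxSr A c) _.
have [_ <-] := mxrank_leqif_sup (addsmxSl A c).
by rewrite eqn_leq mxrankS ?addsmxSl.
Qed.

(** Through coordinates, an intermediate space is a row space in K^d. *)
Lemma quotient_has_dim_split V (U W Z : set V) d :
  linear_subspace U -> linear_subspace W -> linear_subspace Z ->
  U `<=` W -> W `<=` Z -> quotient_has_dim U Z d ->
  exists a b, quotient_has_dim U W a /\ quotient_has_dim W Z b.
Proof.
move=> sU sW sZ UW WZ /quotient_coordP[]//; first exact: subset_trans WZ.
move=> phi [lphi kphi sphi].
have sS : linear_subspace (phi @` W).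
  split; first by exists 0; [exact: subspace0|exact: (linear_on0 sZ lphi)].
  move=> k _ _ [x Wx <-] [y Wy <-]; exists (k *: x + y).
    by apply: subspaceD => //; exact: subspaceZ.
  by rewrite lphi//; exact: WZ.
have WP z : Z z -> (phi @` W) (phi z) -> W z.
  move=> Zz [w Ww pwz]; rewrite -[z](subrK w); apply: subspaceD => //.
  apply/UW/kphi; first by apply: subspaceB => //; exact: WZ.
  by rewrite (linear_onB sZ lphi) ?pwz ?subrr//; exact: WZ.
have [r [B [Bfree SB]]] := subspace_rowspace sS.
exists r, (\rank (cokermx B)); split.
  apply/quotient_coordP => //; exists (fun w => phi w *m pinvmx B).
  have phiK w : W w -> phi w *m pinvmx B *m B = phi w.
    by move=> Ww; rewrite mulmxKpV//; apply/SB; exists w.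
  split=> [k x y Wx Wy|w Ww|c].
  - by rewrite lphi ?mulmxDl ?scalemxAl//; exact: WZ.
  - rewrite -kphi; last exact: WZ.
    by split=> [|->]; rewrite ?mul0mx// => p0; rewrite -phiK// p0 mul0mx.
  - have [w Ww pw] := (SB (c *m B)).2 (submxMl _ _).
    exists w => //; apply: (row_free_inj Bfree); first by rewrite phiK.
apply/quotient_coordP => //.
have cbfull := col_base_full (cokermx B).
exists (fun z => phi z *m col_base (cokermx B)); split=> [k x y Zx Zy|z Zz|c].
- by rewrite lphi// mulmxDl scalemxAl.
- have -> : (W z) = (phi z *m cokermx B == 0).
    apply/propext; rewrite -submxE; rewrite -SB; split=> [Wz|]; first by exists z.
    exact: WP.
  split=> [c0|/eqP].
    by apply/eqP; rewrite -(mulmx_base (cokermx B)) mulmxA c0 mul0mx.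
  rewrite -[X in _ *m X = _](mulmx_base (cokermx B)) mulmxA => c0.
  by apply: (row_free_inj (row_base_free (cokermx B))); rewrite c0 mul0mx.
- have /row_fullP[L LK] := cbfull.
  have [z Zz pz] := sphi (c *m L); exists z => //.
  by rewrite pz -mulmxA LK mulmx1.
Qed.

Lemma quotient_has_dim_prod V V1 V2 (U W : set V) (U1 W1 : set V1)
    (U2 W2 : set V2) (f1 : V -> V1) (f2 : V -> V2) a b :
  linear_subspace U -> linear_subspace W -> U `<=` W ->
  linear_subspace U1 -> linear_subspace W1 -> U1 `<=` W1 ->
  linear_subspace U2 -> linear_subspace W2 -> U2 `<=` W2 ->
  linear_on W f1 -> linear_on W f2 ->
  (forall w, W w -> W1 (f1 w) /\ W2 (f2 w)) ->
  (forall w, W w -> (U w <-> U1 (f1 w) /\ U2 (f2 w))) ->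
  (forall w1 w2, W1 w1 -> W2 w2 -> exists2 w, W w & f1 w = w1 /\ f2 w = w2) ->
  quotient_has_dim U1 W1 a -> quotient_has_dim U2 W2 b ->
  quotient_has_dim U W (a + b).
Proof.
move=> sU sW UW sU1 sW1 UW1 sU2 sW2 UW2 l1 l2 fW fU fs.
move=> /quotient_coordP[]// p1 [lp1 kp1 sp1].
move=> /quotient_coordP[]// p2 [lp2 kp2 sp2].
apply/quotient_coordP => //; exists (fun w => row_mx (p1 (f1 w)) (p2 (f2 w))).
split=> [k x y Wx Wy|w Ww|c].
- have [? ?] := fW _ Wx; have [? ?] := fW _ Wy.
  by rewrite l1// l2// lp1// lp2// scale_row_mx add_row_mx.
- have [? ?] := fW _ Ww.
  rewrite fU// -kp1// -kp2// -[0](row_mx0 _ 1 a b); split=> [/eq_row_mx//|].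
  by move=> [-> ->].
- have [w1 Ww1 e1] := sp1 (lsubmx c); have [w2 Ww2 e2] := sp2 (rsubmx c).
  have [w Ww [ew1 ew2]] := fs _ _ Ww1 Ww2; exists w => //.
  by rewrite ew1 ew2 e1 e2 hsubmxK.
Qed.

End Quotients.

(** * The index of linear maps between subspaces *)

Section AlgebraicIndex.
Context {K : numFieldType}.
Implicit Types X Y Z : lmodType K.

(** The purely algebraic part of the Fredholm property, with the dimensions of
   the kernel and of the cokernel. *)
Definition has_dims X Y (T : X -> Y) (D : set X) (E : set Y) (a b : nat) :=
  quotient_has_dim [set 0] (kernel_in T D) a /\ quotient_has_dim (T @` D) E b.

Definition linear_map_on X Y (D : set X) (E : set Y) (T : X -> Y) :=
  linear_on D T /\ forall x, D x -> E (T x).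

Definition linear_bij_on X Y (D : set X) (E : set Y) (T : X -> Y) :=
  [/\ linear_map_on D E T, forall x, D x -> T x = 0 -> x = 0 &
      forall y, E y -> exists2 x, D x & T x = y].

Lemma subspace_set0 X : linear_subspace [set 0 : X].
Proof. by split=> //= k x y -> ->; rewrite scaler0 addr0. Qed.

Lemma kernel_subspace X Y (T : X -> Y) D E :
  linear_subspace D -> linear_map_on D E T -> linear_subspace (kernel_in T D).
Proof.
move=> sD [lT _]; split.
  by split; [exact: subspace0|exact: (linear_on0 sD lT)].
move=> k x y [Dx Tx] [Dy Ty]; split; last by rewrite lT// Tx Ty scaler0 addr0.
by apply: subspaceD => //; exact: subspaceZ.
Qed.

Lemma image_subspace X Y (T : X -> Y) D E :
  linear_subspace D -> linear_map_on D E T -> linear_subspace (T @` D).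
Proof.
move=> sD [lT _]; split.
  by exists 0; [exact: subspace0|exact: (linear_on0 sD lT)].
move=> k _ _ [x Dx <-] [y Dy <-]; exists (k *: x + y); last by rewrite lT.
by apply: subspaceD => //; exact: subspaceZ.
Qed.

Lemma linear_image_sub X Y (T : X -> Y) D E : linear_map_on D E T -> T @` D `<=` E.
Proof. by move=> [_ TE] _ [x Dx <-]; exact: TE. Qed.

Lemma set0_sub X (W : set X) : linear_subspace W -> [set 0] `<=` W.
Proof. by move=> sW _ ->; exact: subspace0. Qed.

Lemma linear_map_on_comp X Y Z (T : X -> Y) (S : Y -> Z) D E H :
  linear_map_on D E T -> linear_map_on E H S -> linear_map_on D H (S \o T).
Proof.
move=> [lT TE] [lS SH]; split=> [k x y Dx Dy|x Dx] /=; last exact/SH/TE.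
by rewrite lT// lS//; exact: TE.
Qed.

(** With I = TD meet ker S and J = TD + ker S, the four quotients
   ker ST / ker T = I, ker S / I = J / TD, E / J = SE / STD account for all
   the dimensions involved. *)
Lemma has_dims_comp X Y Z (T : X -> Y) (S : Y -> Z) D E H a b c d :
  linear_subspace D -> linear_subspace E -> linear_subspace H ->
  linear_map_on D E T -> linear_map_on E H S ->
  has_dims T D E a b -> has_dims S E H c d ->
  exists p q, has_dims (S \o T) D H p q /\ (p + b + d = a + c + q)%N.
Proof.
move=> sD sE sH mT mS [kTa cTb] [kSc cSd].
have mST := linear_map_on_comp mT mS.
have [lT TE] := mT; have [lS SH] := mS.
have skT := kernel_subspace sD mT; have skS := kernel_subspace sE mS.
have sTD := image_subspace sD mT; have sSE := image_subspace sE mS.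
have skST := kernel_subspace sD mST; have sSTD := image_subspace sD mST.
pose I := [set y | (T @` D) y /\ kernel_in S E y].
pose J := [set y | exists t k, [/\ (T @` D) t, kernel_in S E k & y = t + k]].
have sI : linear_subspace I.
  split; first by split; [exact: (subspace0 sTD)|exact: (subspace0 skS)].
  by move=> k x y [? ?] [? ?]; split; apply: subspaceD => //; exact: subspaceZ.
have sJ : linear_subspace J.
  split.
    exists 0, 0; split; [exact: (subspace0 sTD)|exact: (subspace0 skS)|].
    by rewrite addr0.
  move=> k _ _ [t [u [Tt ku ->]]] [t' [u' [Tt' ku' ->]]].
  exists (k *: t + t'), (k *: u + u'); split.
  - by apply: subspaceD => //; exact: subspaceZ.
  - by apply: subspaceD => //; exact: subspaceZ.
  - by rewrite scalerDr addrACA.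
have IkS : I `<=` kernel_in S E by move=> y [].
have TDJ : T @` D `<=` J.
  by move=> y Ty; exists y, 0; split=> //; [exact: (subspace0 skS)|rewrite addr0].
have JE : J `<=` E.
  move=> _ [t [k [Tt [Ek _] ->]]]; apply: subspaceD => //.
  exact: linear_image_sub Tt.
have [a1 [c1 [HI HkS]]] :=
  quotient_has_dim_split (subspace_set0 Y) sI skS (set0_sub sI) IkS kSc.
have [c2 [b1 [HJ HE]]] := quotient_has_dim_split sTD sJ sE TDJ JE cTb.
have ec : c = (a1 + c1)%N.
  apply: (quotient_has_dim_uniq (subspace_set0 Y) skS (set0_sub skS) kSc).
  exact: (quotient_has_dimD (subspace_set0 Y) sI skS (set0_sub sI) IkS HI HkS).
have eb : b = (c2 + b1)%N.
  apply: (quotient_has_dim_uniq sTD sE (linear_image_sub mT) cTb).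
  exact: (quotient_has_dimD sTD sJ sE TDJ JE HJ HE).
have e12 : c1 = c2.
  apply: (quotient_has_dim_uniq sI skS IkS HkS).
  apply/(quotient_has_dim_map (f := id) (U' := T @` D) (W' := J)) => //.
  - by move=> w kw; exists 0, w; split; [exact: (subspace0 sTD)| |rewrite add0r].
  - by move=> w kw; split=> [|[]].
  - by move=> _ [t [k [Tt kk ->]]]; exists k => //; rewrite addrK.
have kTST : kernel_in T D `<=` kernel_in (S \o T) D.
  by move=> x [Dx Tx]; split=> //=; rewrite Tx (linear_on0 sE lS).
have STSE : (S \o T) @` D `<=` S @` E.
  by move=> _ [x Dx <-]; exists (T x) => //; exact: TE.
have HkST : quotient_has_dim (kernel_in T D) (kernel_in (S \o T) D) a1.
  apply/(quotient_has_dim_map (f := T) (U' := [set 0]) (W' := I)) => //.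
  - exact: subspace_set0.
  - exact: set0_sub.
  - by move=> k x y [? _] [? _]; exact: lT.
  - move=> x [Dx STx]; split; first by exists x.
    by split=> //; exact: TE.
  - by move=> x [Dx STx]; split=> [|[]].
  - by move=> _ [[x Dx <-] [_ STx]]; exists x; rewrite ?subrr.
have HSTD : quotient_has_dim ((S \o T) @` D) (S @` E) b1.
  apply/(quotient_has_dim_map (f := S) (U := J) (W := E)) => //.
  - move=> y Ey; split=> [[x Dx /= e]|[t [k [[x Dx <-] [Ek Sk] ->]]]].
      exists (T x), (y - T x); split; [by exists x| |by rewrite addrC subrK].
      split; first by apply: subspaceB => //; exact: TE.
      by rewrite (linear_onB sE lS)// ?e ?subrr//; exact: TE.
    exists x => //=; rewrite (linear_onD lS) ?Sk ?addr0//; exact: TE.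
  - move=> _ [y Ey <-]; exists y => //.
    by rewrite subrr; exact: subspace0.
exists (a + a1)%N, (b1 + d)%N; split; last by rewrite ec eb -e12; lia.
split.
  exact: (quotient_has_dimD (subspace_set0 X) skT skST (set0_sub skT) kTST).
exact: (quotient_has_dimD sSTD sSE sH STSE (linear_image_sub mS) HSTD cSd).
Qed.

Lemma has_dims_uniq X Y (T : X -> Y) D E a b a' b' :
  linear_subspace D -> linear_subspace E -> linear_map_on D E T ->
  has_dims T D E a b -> has_dims T D E a' b' -> a = a' /\ b = b'.
Proof.
move=> sD sE mT [ka cb] [ka' cb'].
have sk := kernel_subspace sD mT; have sI := image_subspace sD mT.
split; first exact: (quotient_has_dim_uniq (subspace_set0 X) sk (set0_sub sk) ka ka').
exact: (quotient_has_dim_uniq sI sE (linear_image_sub mT) cb cb').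
Qed.

(** The kernel of T lies in that of S T, and the range of T contains that of
   T S. *)
Lemma has_dims_sandwich X Y (T : X -> Y) (S : Y -> X) D E a b c d :
  linear_subspace D -> linear_subspace E ->
  linear_map_on D E T -> linear_map_on E D S ->
  has_dims (S \o T) D D a b -> has_dims (T \o S) E E c d ->
  exists p q, has_dims T D E p q.
Proof.
move=> sD sE mT mS [ka _] [_ cd].
have mST := linear_map_on_comp mT mS; have mTS := linear_map_on_comp mS mT.
have kTST : kernel_in T D `<=` kernel_in (S \o T) D.
  by move=> x [Dx Tx]; split=> //=; rewrite Tx (linear_on0 sE mS.1).
have TST : (T \o S) @` E `<=` T @` D.
  by move=> _ [x Ex <-]; exists (S x) => //; exact: mS.2.
have skT := kernel_subspace sD mT.
have [p [_ [Hp _]]] := quotient_has_dim_split (subspace_set0 X) skT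
  (kernel_subspace sD mST) (set0_sub skT) kTST ka.
have [_ [q [_ Hq]]] := quotient_has_dim_split (image_subspace sE mTS)
  (image_subspace sD mT) sE TST (linear_image_sub mT) cd.
by exists p, q.
Qed.

(** Both indices are the opposite of the index of S. *)
Lemma index_common_parametrix X Y (T T' : X -> Y) (S : Y -> X) D E a b c d :
  linear_subspace D -> linear_subspace E ->
  linear_map_on D E T -> linear_map_on D E T' -> linear_map_on E D S ->
  has_dims (S \o T) D D a a -> has_dims (T \o S) E E b b ->
  has_dims (S \o T') D D c c -> has_dims (T' \o S) E E d d ->
  exists p q p' q', [/\ has_dims T D E p q, has_dims T' D E p' q' &
    p%:Z - q%:Z = p'%:Z - q'%:Z].
Proof.
move=> sD sE mT mT' mS ST TS ST' T'S.
have [p [q HT]] := has_dims_sandwich sD sE mT mS ST TS.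
have [p' [q' HT']] := has_dims_sandwich sD sE mT' mS ST' T'S.
have [r [s HS]] := has_dims_sandwich sE sD mS mT TS ST.
exists p, q, p', q'; split=> //.
have [u [v [HST e]]] := has_dims_comp sD sE sD mT mS HT HS.
have [u' [v' [HST' e']]] := has_dims_comp sD sE sD mT' mS HT' HS.
have [? ?] := has_dims_uniq sD sD (linear_map_on_comp mT mS) ST HST.
have [? ?] := has_dims_uniq sD sD (linear_map_on_comp mT' mS) ST' HST'.
lia.
Qed.

Lemma has_dims_conj X Y X' Y' (T : X -> Y) (T' : X' -> Y') D E D' E' u v a b :
  linear_subspace D -> linear_subspace E ->
  linear_subspace D' -> linear_subspace E' ->
  linear_map_on D E T -> linear_map_on D' E' T' ->
  linear_bij_on D D' u -> linear_bij_on E E' v ->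
  (forall x, D x -> v (T x) = T' (u x)) ->
  has_dims T D E a b <-> has_dims T' D' E' a b.
Proof.
move=> sD sE sD' sE' mT mT' [[lu uD] ui us] [[lv vE] vi vs] uv.
have skT := kernel_subspace sD mT; have skT' := kernel_subspace sD' mT'.
have HK := @quotient_has_dim_map K X X' [set 0] (kernel_in T D) [set 0]
  (kernel_in T' D') u a (subspace_set0 X) skT (set0_sub skT)
  (subspace_set0 X') skT' (set0_sub skT').
have HC := @quotient_has_dim_map _ Y Y' (T @` D) E (T' @` D') E' v b
  (image_subspace sD mT) sE (linear_image_sub mT)
  (image_subspace sD' mT') sE' (linear_image_sub mT').
rewrite /has_dims HK ?HC//.
- move=> y Ey; split=> [[x' Dx' e]|[x Dx <-]].
    have [x Dx ex] := us _ Dx'; exists x => //.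
    apply/eqP; rewrite -subr_eq0; apply/eqP/vi.
      by apply: subspaceB => //; exact: mT.2.
    rewrite (linear_onB sE lv)//; last exact: mT.2.
    by rewrite uv// ex e subrr.
  by exists (u x); [exact: uD|rewrite uv].
- move=> y' Ey'; have [y Ey <-] := vs _ Ey'; exists y => //.
  by rewrite subrr; apply: subspace0; exact: image_subspace mT'.
- by move=> k x y [? _] [? _]; exact: lu.
- move=> x [Dx Tx]; split; first exact: uD.
  by rewrite -uv// Tx (linear_on0 sE lv).
- move=> x [Dx Tx]; split=> [/= ux|/= ->]; first exact: ui.
  exact: (linear_on0 sD lu).
- move=> x' [Dx' Tx']; have [x Dx ex] := us _ Dx'.
  exists x; last by rewrite ex subrr.
  split=> //; apply: vi; first exact: mT.2.
  by rewrite uv// ex.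
Qed.

Lemma has_dims_prod X Y X1 Y1 X2 Y2 (T : X -> Y) (T1 : X1 -> Y1)
    (T2 : X2 -> Y2) D E D1 E1 D2 E2 u1 u2 v1 v2 a b c d :
  linear_subspace D -> linear_subspace E ->
  linear_subspace D1 -> linear_subspace E1 ->
  linear_subspace D2 -> linear_subspace E2 ->
  linear_map_on D E T -> linear_map_on D1 E1 T1 -> linear_map_on D2 E2 T2 ->
  linear_map_on D D1 u1 -> linear_map_on D D2 u2 ->
  linear_map_on E E1 v1 -> linear_map_on E E2 v2 ->
  (forall x, D x -> u1 x = 0 -> u2 x = 0 -> x = 0) ->
  (forall x1 x2, D1 x1 -> D2 x2 -> exists2 x, D x & u1 x = x1 /\ u2 x = x2) ->
  (forall y, E y -> v1 y = 0 -> v2 y = 0 -> y = 0) ->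
  (forall y1 y2, E1 y1 -> E2 y2 -> exists2 y, E y & v1 y = y1 /\ v2 y = y2) ->
  (forall x, D x -> v1 (T x) = T1 (u1 x)) ->
  (forall x, D x -> v2 (T x) = T2 (u2 x)) ->
  has_dims T1 D1 E1 a b -> has_dims T2 D2 E2 c d ->
  has_dims T D E (a + c) (b + d).
Proof.
move=> sD sE sD1 sE1 sD2 sE2 mT mT1 mT2 [lu1 uD1] [lu2 uD2] [lv1 vE1]
  [lv2 vE2] ui us vi vs uv1 uv2 [k1 c1] [k2 c2].
have sk := kernel_subspace sD mT.
have sk1 := kernel_subspace sD1 mT1; have sk2 := kernel_subspace sD2 mT2.
have s0 := @subspace_set0.
have TD0 x : D x -> v1 (T x) = 0 -> v2 (T x) = 0 -> T x = 0.
  by move=> Dx; apply: vi; exact: mT.2.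
split.
  apply: (quotient_has_dim_prod (s0 _) sk (set0_sub sk) (s0 _) sk1
    (set0_sub sk1) (s0 _) sk2 (set0_sub sk2) _ _ _ _ _ k1 k2 (f1 := u1) (f2 := u2)).
  - by move=> k x y [? _] [? _]; exact: lu1.
  - by move=> k x y [? _] [? _]; exact: lu2.
  - move=> x [Dx Tx]; split; split; [exact: uD1| |exact: uD2|].
      by rewrite -uv1// Tx (linear_on0 sE lv1).
    by rewrite -uv2// Tx (linear_on0 sE lv2).
  - move=> x [Dx _]; split=> [/= ->|[/= ? ?]]; last exact: ui.
    by rewrite /= (linear_on0 sD lu1) (linear_on0 sD lu2).
  - move=> x1 x2 [Dx1 Tx1] [Dx2 Tx2]; have [x Dx [e1 e2]] := us _ _ Dx1 Dx2.
    by exists x => //; split=> //; apply: TD0; rewrite ?uv1 ?uv2 ?e1 ?e2.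
apply: (quotient_has_dim_prod (image_subspace sD mT) sE (linear_image_sub mT)
  (image_subspace sD1 mT1) sE1 (linear_image_sub mT1)
  (image_subspace sD2 mT2) sE2 (linear_image_sub mT2) lv1 lv2 _ _ _ c1 c2).
- by move=> y Ey; split; [exact: vE1|exact: vE2].
- move=> y Ey; split=> [[x Dx <-]|[[x1 Dx1 e1] [x2 Dx2 e2]]].
    by split; [exists (u1 x); [exact: uD1|rewrite uv1]|
               exists (u2 x); [exact: uD2|rewrite uv2]].
  have [x Dx [f1 f2]] := us _ _ Dx1 Dx2; exists x => //.
  have ETx := mT.2 _ Dx.
  apply/eqP; rewrite -subr_eq0; apply/eqP/vi; first exact: subspaceB.
    by rewrite (linear_onB sE lv1)// uv1// f1 e1 subrr.
  by rewrite (linear_onB sE lv2)// uv2// f2 e2 subrr.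
- exact: vs.
Qed.

Lemma has_dims_bij X Y (T : X -> Y) D E :
  linear_subspace D -> linear_subspace E -> linear_bij_on D E T ->
  has_dims T D E 0 0.
Proof.
have triv (V : lmodType K) (U : set V) : linear_subspace U -> quotient_has_dim U U 0.
  move=> sU; exists (fun=> 0); split=> [[]//|w Uw]; exists 0; split.
    by rewrite big_ord0 subr0.
  by move=> c _; apply/rowP => -[].
move=> sD sE [mT Ti Ts]; split.
  have -> : kernel_in T D = [set 0].
    apply/seteqP; split=> [x [Dx Tx]|x ->]; first exact: Ti.
    by split; [exact: subspace0|exact: (linear_on0 sD mT.1)].
  exact/triv/subspace_set0.
have -> : T @` D = E; last exact: triv.
apply/seteqP; split; first exact: linear_image_sub.
by move=> y Ey; have [x Dx <-] := Ts _ Ey; exists x.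
Qed.

End AlgebraicIndex.

(** * The Banach space of complex numbers *)

Section ComplexComplete.
Context {R : realType}.

(** The complex line as a Banach space; the name keeps its completeness apart
   from that of the regular module of a real field. *)
Definition cline : Type := R[i]^o.

HB.instance Definition _ := NormedModule.copy cline R[i]^o.

Lemma cline_complete (F : set_system cline) :
  ProperFilter F -> cauchy F -> cvg F.
Proof.
move=> FF Fc.
have nRe (z : R[i]) : `|complex.Re z|%:C%C <= `|z|.
  rewrite normc_def lecR -sqrtr_sqr; apply: ler_wsqrtr.
  by rewrite lerDl sqr_ge0.
have nIm (z : R[i]) : `|complex.Im z|%:C%C <= `|z|.
  rewrite normc_def lecR -sqrtr_sqr; apply: ler_wsqrtr.
  by rewrite lerDr sqr_ge0.
have part (p : {additive R[i] -> R}) : (forall z, `|p z|%:C%C <= `|z|) ->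
    cvg (p @ F).
  move=> np; apply: cauchy_cvg; apply/cauchy_ballP => e e0.
  rewrite !near_simpl.
  have e0' : 0 < e%:C%C :> R[i] by rewrite ltcR.
  have /cauchy_ballP /(_ _ e0') := Fc.
  apply: filterS => -[x y]; rewrite -!ball_normE /ball_ /= => xy.
  by rewrite -ltcR -raddfB; apply: le_lt_trans (np _) xy.
have dE (a b : R) (z : R[i]) : (a +i* b)%C - z =
    (a - complex.Re z)%:C%C + 'i%C * (b - complex.Im z)%:C%C.
  apply/eqP; rewrite eq_complex; case: z => c d /=.
  by apply/andP; split; apply/eqP; ring.
have := part (@complex.Re R) nRe; have := part (@complex.Im R) nIm.
move=> cIm cRe.
apply/cvg_ex; exists (lim (@complex.Re R @ F) +i* lim (@complex.Im R @ F))%C.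
apply/cvgrPdist_lt => e e0.
have [r r0 er] : exists2 r : R, 0 < r & e = r%:C%C.
  by exists (complex.Re e); [move: e0; rewrite ltcE => /andP[]|
    rewrite RRe_real// ger0_real// ltW].
have r2 : 0 < r / 2 by rewrite divr_gt0.
have /cvgrPdist_lt /(_ _ r2) h1 := cRe.
have /cvgrPdist_lt /(_ _ r2) h2 := cIm.
near=> z.
rewrite dE.
apply: le_lt_trans (ler_normD _ _) _.
rewrite normrM !normc_def /= !expr0n expr1n /= !addr0 add0r !sqrtr_sqr.
rewrite sqrtr1 mul1r -rmorphD er ltcR.
rewrite [r]splitr ltrD//; near: z; [exact: h1|exact: h2].
Unshelve. all: by end_near. Qed.

HB.instance Definition _ := isPointed.Build cline 0.
HB.instance Definition _ := Uniform_isComplete.Build cline cline_complete.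
End ComplexComplete.

(** * Bounded and compact linear maps *)

Section RealNorm.
Context {R : realType}.
Implicit Types X Y Z : completeNormedModType R[i].

(** The norm as a real number, since the order of R[i] is only partial. *)
Definition nrm X (x : X) : R := complex.Re `|x|.

Lemma nrmE X (x : X) : `|x| = (nrm x)%:C%C.
Proof. by rewrite /nrm RRe_real// ger0_real. Qed.

Lemma nrm_ge0 X (x : X) : 0 <= nrm x.
Proof. by rewrite -lecR -nrmE; exact: normr_ge0. Qed.

Lemma nrm0 X : nrm (0 : X) = 0.
Proof. by apply: complexI; rewrite -nrmE normr0. Qed.

Lemma nrm0_eq0 X (x : X) : nrm x <= 0 -> x = 0.
Proof.
move=> x0; apply/eqP; rewrite -normr_eq0 nrmE; apply/eqP; congr (_%:C)%C.
by apply/eqP; rewrite eq_le x0 nrm_ge0.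
Qed.

Lemma nrm_gt0 X (x : X) : x != 0 -> 0 < nrm x.
Proof. by move=> x0; rewrite -ltcR -nrmE normr_gt0. Qed.

Lemma nrmN X (x : X) : nrm (- x) = nrm x.
Proof. by rewrite /nrm normrN. Qed.

Lemma nrmC X (x y : X) : nrm (x - y) = nrm (y - x).
Proof. by rewrite -nrmN opprB. Qed.

Lemma nrmD X (x y : X) : nrm (x + y) <= nrm x + nrm y.
Proof. by rewrite -lecR rmorphD/= -!nrmE ler_normD. Qed.

Lemma nrm_triangle X (z x y : X) : nrm (x - y) <= nrm (x - z) + nrm (z - y).
Proof. by rewrite -[x - y](subrKA z); exact: nrmD. Qed.

Lemma nrmZ X (k : R[i]) (x : X) : nrm (k *: x) = nrm (k : cline) * nrm x.
Proof. by apply: complexI; rewrite rmorphM/= -!nrmE normrZ. Qed.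

Lemma nrm_cline (r : R) : 0 <= r -> nrm (r%:C%C : cline) = r.
Proof.
move=> r0; apply: complexI; rewrite -nrmE.
have r0' : 0 <= r%:C%C by rewrite ler0c.
exact: (ger0_norm r0').
Qed.

Lemma nrmZr X (k : R) (x : X) : 0 <= k -> nrm (k%:C%C *: x) = k * nrm x.
Proof.
move=> k0; apply: complexI; rewrite rmorphM/= -!nrmE normrZ.
by congr (_ * _); rewrite ger0_norm// ler0c.
Qed.

Lemma nrm_bpow X n (x : bpow X n) :
  nrm x = \sum_i nrm ((x : {ffun 'I_n -> X}) i).
Proof.
apply: complexI; rewrite -nrmE rmorph_sum/=.
by rewrite [LHS]/Num.norm/= /bpow_norm; apply: eq_bigr => i _; rewrite nrmE.
Qed.

Lemma nrm_bpow_coord X n (x : bpow X n) i :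
  nrm ((x : {ffun 'I_n -> X}) i) <= nrm x.
Proof.
rewrite nrm_bpow (bigD1 i)//= lerDl; apply: sumr_ge0 => j _; exact: nrm_ge0.
Qed.

Lemma half_ge0 : 0 <= 2^-1 :> R.
Proof. by rewrite invr_ge0. Qed.

Lemma half_expn_ge0 n : 0 <= 2^-1 ^+ n :> R.
Proof. by rewrite exprn_ge0// half_ge0. Qed.

Lemma half_expn_small (C e : R) : 0 < e -> exists N : nat, C * 2^-1 ^+ N < e.
Proof.
move=> e0; have [C0|C0] := leP C 0.
  by exists 0%N; rewrite expr0 mulr1; exact: le_lt_trans e0.
exists (Num.bound (C / e)).
have : C / e < 2 ^+ Num.bound (C / e).
  apply: (@lt_le_trans _ _ (Num.bound (C / e))%:R).
    by apply: archi_boundP; rewrite divr_ge0// ltW.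
  by rewrite -natrX ler_nat ltnW// ltn_expl.
by rewrite ltr_pdivrMr// mulrC exprVn ltr_pdivrMr// exprn_gt0.
Qed.

Lemma invS_small (e : R) : 0 < e -> exists N : nat, N.+1%:R^-1 < e.
Proof.
move=> e0; exists (Num.bound e^-1).
rewrite invf_plt ?posrE//; apply: lt_trans (archi_boundP _) _.
  by rewrite invr_ge0 ltW.
by rewrite ltr_nat.
Qed.

Lemma le_small (a b : R) : (forall e, 0 < e -> a <= b + e) -> a <= b.
Proof. by move=> h; apply/ler_addgt0Pr => e /h. Qed.

Lemma geometric_lim X (u : nat -> X) (C : R) :
  (forall n, nrm (u n.+1 - u n) <= C * 2^-1 ^+ n) ->
  exists l, forall n, nrm (u n - l) <= 2 * C * 2^-1 ^+ n.
Proof.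
move=> uC.
have C0 : 0 <= C by have := uC 0%N; rewrite expr0 mulr1; apply/le_trans/nrm_ge0.
have far n k : nrm (u (n + k)%N - u n) <= 2 * C * 2^-1 ^+ n * (1 - 2^-1 ^+ k).
  elim: k => [|k IH]; first by rewrite addn0 !subrr nrm0 mulr0.
  rewrite addnS; apply: le_trans (nrm_triangle (u (n + k)%N) _ _) _.
  apply: le_trans (lerD (uC _) IH) _.
  by rewrite exprD exprS le_eqVlt; apply/orP; left; apply/eqP; field.
have farle n m : (n <= m)%N -> nrm (u m - u n) <= 2 * C * 2^-1 ^+ n.
  move=> /subnKC <-; apply: le_trans (far _ _) _.
  rewrite ler_piMr//; first by apply: mulr_ge0; [exact: mulr_ge0|exact: half_expn_ge0].
  by rewrite gerBl half_expn_ge0.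
have cu : cvg (u @ \oo).
  apply: cauchy_cvg; apply: cauchy_exP => e e0.
  have [r r0 er] : exists2 r : R, 0 < r & e = r%:C%C.
    by exists (complex.Re e); [move: e0; rewrite ltcE => /andP[]|
      rewrite RRe_real// ger0_real// ltW].
  have [N hN] := half_expn_small (2 * C) r0.
  exists (u N); exists N => //= m /= Nm.
  rewrite -ball_normE /ball_/= nrmE er ltcR nrmC.
  exact: le_lt_trans (farle _ _ Nm) hN.
exists (lim (u @ \oo)) => n; apply: le_small => e e0.
have e0' : 0 < e%:C%C :> R[i] by rewrite ltcR.
have /cvgrPdist_lt /(_ _ e0') [N _ hN] := cu.
have := hN (maxn n N) (leq_maxr _ _); rewrite /= nrmE ltcR => /ltW h.
apply: le_trans (nrm_triangle (u (maxn n N)) _ _) _.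
rewrite nrmC [X in _ + X]nrmC; apply: lerD h.
by rewrite farle// leq_maxl.
Qed.

Definition bdd_lin X Y (f : X -> Y) : Prop :=
  linear f /\ exists M : R, 0 <= M /\ forall x, nrm (f x) <= M * nrm x.

Section Linear.
Context {X Y : lmodType R[i]} (f : X -> Y).
Hypothesis lf : linear f.
Lemma lin0 : f 0 = 0.
Proof. by apply: (addrI (f 0)); rewrite -{1}[f 0]scale1r -lf scale1r !addr0. Qed.
Lemma linD x y : f (x + y) = f x + f y.
Proof. by rewrite -[x]scale1r lf !scale1r. Qed.
Lemma linZ k x : f (k *: x) = k *: f x.
Proof. by rewrite -[k *: x]addr0 lf lin0 addr0. Qed.
Lemma linN x : f (- x) = - f x.
Proof. by rewrite -scaleN1r linZ scaleN1r. Qed.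
Lemma linB x y : f (x - y) = f x - f y.
Proof. by rewrite linD linN. Qed.
Lemma lin_on D : linear_on D f.
Proof. by move=> k x y _ _; exact: lf. Qed.
End Linear.

Lemma bdd_lin_op X Y (f : {linear X -> Y}) : bounded_op f -> bdd_lin f.
Proof.
move=> [M fM]; split; first by move=> k x y; rewrite linearP.
exists (nrm (M : cline)); split=> [|x]; first exact: nrm_ge0.
rewrite -lecR rmorphM/= -!nrmE -[X in _ * X]normr_id -normrM ger0_norm//.
exact: le_trans (fM x).
Qed.

Lemma bdd_lin_comp X Y Z (f : X -> Y) (g : Y -> Z) :
  bdd_lin f -> bdd_lin g -> bdd_lin (g \o f).
Proof.
move=> [lf [M [M0 fM]]] [lg [N [N0 gN]]]; split=> [k x y|] /=.
  by rewrite lf lg.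
exists (N * M); split=> [|x]; first exact: mulr_ge0.
by apply: le_trans (gN _) _; rewrite -mulrA ler_wpM2l.
Qed.

Lemma bdd_linD X Y (f g : X -> Y) :
  bdd_lin f -> bdd_lin g -> bdd_lin (fun x => f x + g x).
Proof.
move=> [lf [M [M0 fM]]] [lg [N [N0 gN]]]; split=> [k x y|] /=.
  by rewrite lf lg scalerDr addrACA.
exists (M + N); split=> [|x]; first exact: addr_ge0.
by apply: le_trans (nrmD _ _) _; rewrite mulrDl lerD.
Qed.

Lemma bdd_linZ X Y k (f : X -> Y) : bdd_lin f -> bdd_lin (fun x => k *: f x).
Proof.
move=> [lf [M [M0 fM]]]; split=> [l x y|] /=.
  by rewrite lf scalerDr !scalerA mulrC.
exists (nrm (k : cline) * M); split=> [|x]; first by rewrite mulr_ge0 ?nrm_ge0.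
by rewrite nrmZ -mulrA ler_wpM2l// nrm_ge0.
Qed.

Lemma bdd_linB X Y (f g : X -> Y) :
  bdd_lin f -> bdd_lin g -> bdd_lin (fun x => f x - g x).
Proof.
move=> bf bg; have := bdd_linD bf (bdd_linZ (-1) bg).
by congr bdd_lin; apply/funext => x; rewrite scaleN1r.
Qed.

Lemma bdd_lin_id X : bdd_lin (@id X).
Proof. by split=> //; exists 1; split=> // x; rewrite mul1r. Qed.

Lemma bdd_lin0 X Y : bdd_lin (fun _ : X => 0 : Y).
Proof.
split=> [k x y|]; first by rewrite scaler0 addr0.
by exists 0; split=> // x; rewrite nrm0 mul0r.
Qed.

Lemma bdd_lin_sum X Y n (f : 'I_n -> X -> Y) :
  (forall i, bdd_lin (f i)) -> bdd_lin (fun x => \sum_i f i x).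
Proof.
elim: n f => [|n IH] f bf.
  have := bdd_lin0 X Y; congr bdd_lin; apply/funext => x.
  by rewrite big_ord0.
have := bdd_linD (bf ord0) (IH _ (fun i => bf (lift ord0 i))).
by congr bdd_lin; apply/funext => x; rewrite big_ord_recl.
Qed.

Definition cluster_pt X (z : nat -> X) (w : X) : Prop :=
  forall e : R, 0 < e -> forall N, exists2 n, (N <= n)%N & nrm (z n - w) <= e.

(** Compactness in sequential form, which is stable under sums and compositions
   by extraction of subsequences. *)
Definition seq_compact X Y (f : X -> Y) : Prop :=
  forall x : nat -> X, (forall n, nrm (x n) <= 1) ->
  exists w, cluster_pt (f \o x) w.

Lemma cluster_pt_sub X (z : nat -> X) w : cluster_pt z w ->
  exists phi : nat -> nat, forall n, (n <= phi n)%N /\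
    nrm (z (phi n) - w) <= n.+1%:R^-1.
Proof.
move=> zw; have /choice[phi phiP] n :
    exists p, (n <= p)%N /\ nrm (z p - w) <= n.+1%:R^-1; last by exists phi.
have n0 : 0 < n.+1%:R^-1 :> R by rewrite invr_gt0.
by have [p ? ?] := zw _ n0 n; exists p.
Qed.

Lemma cluster_ptD X (z z' : nat -> X) phi w w' :
  (forall n, (n <= phi n)%N /\ nrm (z (phi n) - w) <= n.+1%:R^-1) ->
  cluster_pt (z' \o phi) w' -> cluster_pt (fun n => z n + z' n) (w + w').
Proof.
move=> zw z'w' e e0 N; have e2 : 0 < e / 2 by rewrite divr_gt0.
have [N' N'e] := invS_small e2.
have [n Nn z'n] := z'w' _ e2 (maxn N N').
have [nphi zn] := zw n; exists (phi n).
  by apply: leq_trans nphi; apply: leq_trans Nn; exact: leq_maxl.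
rewrite opprD addrACA; apply: le_trans (nrmD _ _) _.
rewrite [e]splitr lerD//; apply: le_trans zn _; apply: le_trans (ltW N'e).
by rewrite lef_pV2 ?posrE// ler_nat ltnS; apply: leq_trans Nn; exact: leq_maxr.
Qed.

Lemma cluster_pt_map X Y (f : X -> Y) (z : nat -> X) w :
  bdd_lin f -> cluster_pt z w -> cluster_pt (f \o z) (f w).
Proof.
move=> [lf [M [M0 fM]]] zw e e0 N.
have M1 : 0 < M + 1 by rewrite ltr_wpDl.
have [n Nn zn] := zw (e / (M + 1)) (divr_gt0 e0 M1) N.
exists n => //=; rewrite -(linB lf); apply: le_trans (fM _) _.
apply: (@le_trans _ _ ((M + 1) * nrm (z n - w))).
  by rewrite ler_wpM2r ?nrm_ge0// lerDl.
by rewrite mulrC -ler_pdivlMr.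
Qed.

Lemma seq_compact_op X Y (f : X -> Y) : compact_op f -> seq_compact f.
Proof.
move=> cf x x1.
have [|w [_ cw]] := cf (f \o x @ \oo) _.
  by exists 0%N => // n _; apply: subset_closure; exists (x n) => //=;
    rewrite nrmE -[1]/(1%:C%C) lecR.
exists w => e e0 N.
have e0' : 0 < e%:C%C :> R[i] by rewrite ltcR.
have [||y [/=[n Nn <-] wy]] :=
  cw [set f (x n) | n in [set n | (N <= n)%N]] (ball w e%:C%C).
- by exists N => // n Nn; exists n.
- exact: nbhsx_ballx.
exists n => //=; move: wy; rewrite -ball_normE /ball_/= nrmE ltcR nrmC.
exact: ltW.
Qed.

Definition cpt_lin X Y (f : X -> Y) : Prop := bdd_lin f /\ seq_compact f.

Lemma cpt_lin_compl X Y Z (f : X -> Y) (g : Y -> Z) :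
  cpt_lin f -> bdd_lin g -> cpt_lin (g \o f).
Proof.
move=> [bf cf] bg; split=> [|x /cf[w fw]]; first exact: bdd_lin_comp.
by exists (g w); exact: (cluster_pt_map bg fw).
Qed.

Lemma cpt_lin_compr X Y Z (f : X -> Y) (g : Y -> Z) :
  bdd_lin f -> cpt_lin g -> cpt_lin (g \o f).
Proof.
move=> bf [bg cg]; split=> [|x x1]; first exact: bdd_lin_comp.
have [lf [M [M0 fM]]] := bf.
have M1 : 0 < M + 1 by rewrite ltr_wpDl.
have [n|w gw] := cg (fun n => (M + 1)^-1%:C%C *: f (x n)).
  have M1' : 0 <= (M + 1)^-1 by rewrite invr_ge0 ltW.
  rewrite nrmZr// mulrC ler_pdivrMr// mul1r.
  apply: le_trans (fM _) _; apply: le_trans (_ : M * 1 <= _).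
    by rewrite ler_wpM2l.
  by rewrite mulr1 lerDl.
exists ((M + 1)%:C%C *: w).
have := cluster_pt_map (bdd_linZ (M + 1)%:C%C (bdd_lin_id _)) gw.
congr cluster_pt; apply/funext => n /=.
rewrite (linZ bg.1) scalerA -rmorphM mulfV ?gt_eqF// scale1r.
by [].
Qed.

Lemma cpt_linD X Y (f g : X -> Y) :
  cpt_lin f -> cpt_lin g -> cpt_lin (fun x => f x + g x).
Proof.
move=> [bf cf] [bg cg]; split=> [|x x1]; first exact: bdd_linD.
have [w /cluster_pt_sub[phi fw]] := cf x x1.
have [w' gw] := cg (x \o phi) (fun n => x1 (phi n)).
by exists (w + w'); exact: (cluster_ptD fw gw).
Qed.

Lemma cpt_linZ X Y k (f : X -> Y) : cpt_lin f -> cpt_lin (fun x => k *: f x).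
Proof.
by move=> cf; exact: (cpt_lin_compl cf (bdd_linZ k (bdd_lin_id _))).
Qed.

Lemma cpt_lin0 X Y : cpt_lin (fun _ : X => 0 : Y).
Proof.
split=> [|x _]; first exact: bdd_lin0.
by exists 0 => e e0 N; exists N => //=; rewrite subrr nrm0 ltW.
Qed.

Lemma cpt_lin_sum X Y n (f : 'I_n -> X -> Y) :
  (forall i, cpt_lin (f i)) -> cpt_lin (fun x => \sum_i f i x).
Proof.
elim: n f => [|n IH] f cf.
  have := cpt_lin0 X Y; congr cpt_lin; apply/funext => x.
  by rewrite big_ord0.
have := cpt_linD (cf ord0) (IH _ (fun i => cf (lift ord0 i))).
by congr cpt_lin; apply/funext => x; rewrite big_ord_recl.
Qed.

Lemma seq_compact_not_separated X Y (f : X -> Y) (x : nat -> X) (c : R) :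
  seq_compact f -> 0 < c -> (forall n, nrm (x n) <= 1) ->
  ~ (forall n m, (n < m)%N -> c <= nrm (f (x m) - f (x n))).
Proof.
move=> cf c0 x1 sep; have [w fw] := cf _ x1.
have c3 : 0 < c / 3 by rewrite divr_gt0.
have [n _ fn] := fw _ c3 0%N.
have [m nm fm] := fw _ c3 n.+1.
have := sep _ _ nm; move: fn fm => /=; have := nrm_triangle w (f (x m)) (f (x n)).
rewrite [nrm (w - _)]nrmC; lra.
Qed.

(** The iteration behind the open mapping theorem: the errors decrease
   geometrically, and the corrections have a sum because Y is complete. *)
Lemma approx_surjective X Y (L : Y -> X) (D : set X) (C : R) :
  bdd_lin L -> linear_subspace D -> (forall y, D (L y)) ->
  (forall x, D x -> exists y, nrm y <= C * nrm x /\ nrm (x - L y) <= 2^-1 * nrm x) ->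
  forall x, D x -> exists y, L y = x.
Proof.
move=> [lL [M [M0 LM]]] sD DL ap x Dx.
have /choice[g gP] (z : X) : exists y, D z ->
    nrm y <= C * nrm z /\ nrm (z - L y) <= 2^-1 * nrm z.
  by have [/ap[y ?]|] := pselect (D z); [exists y|exists 0].
pose r n := iter n (fun z => z - L (g z)) x.
have Dr n : D (r n) by elim: n => //= n IH; exact: subspaceB.
have rn n : nrm (r n) <= nrm x * 2^-1 ^+ n.
  elim: n => [|n IH]; first by rewrite expr0 mulr1.
  have [_ h] := gP _ (Dr n); apply: le_trans h _.
  by rewrite exprS mulrCA ler_wpM2l// half_ge0.
pose s n := \sum_(k < n) g (r k).
have Ls n : L (s n) = x - r n.
  elim: n => [|n IH]; first by rewrite /s big_ord0 (lin0 lL) subrr.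
  rewrite /s big_ord_recr/= -/(s n) (linD lL) IH /= opprB addrA.
  by rewrite addrAC.
have [//|l sl] := @geometric_lim _ s (`|C| * nrm x) _.
  move=> n; rewrite (_ : s n.+1 - s n = g (r n)); last first.
    by rewrite /s big_ord_recr/= addrAC subrr add0r.
  have [h _] := gP _ (Dr n); apply: le_trans h _.
  rewrite -mulrA; apply: (@le_trans _ _ (`|C| * nrm (r n))).
    by rewrite ler_wpM2r ?nrm_ge0// ler_norm.
  by rewrite ler_wpM2l.
exists l; apply/eqP; rewrite -subr_eq0; apply/eqP/nrm0_eq0/le_small => e e0.
have [N hN] := half_expn_small (M * (2 * (`|C| * nrm x)) + nrm x) e0.
rewrite add0r; apply: le_trans (ltW hN).
apply: le_trans (nrm_triangle (L (s N)) _ _) _; rewrite mulrDl; apply: lerD.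
  rewrite -(linB lL); apply: le_trans (LM _) _.
  by rewrite -[X in _ <= X]mulrA ler_wpM2l// nrmC.
by rewrite Ls addrAC subrr add0r nrmN.
Qed.

End RealNorm.

(** * Riesz theory of compact perturbations of the identity *)

Section Riesz.
Context {R : realType} {X : completeNormedModType R[i]}.
Implicit Types k : X -> X.

Definition closed_under_limits (V : set X) : Prop :=
  forall x, (forall e : R, 0 < e -> exists2 v, V v & nrm (x - v) <= e) -> V x.

(** A vector of the unit ball at distance at least 1/2 from V. It is returned as
   a multiple of w modulo V, so that an operator that vanishes on V is controlled
   on it by its value at w. *)
Lemma riesz_lemma (V : set X) w :
  linear_subspace V -> closed_under_limits V -> ~ V w ->
  exists (a : R) v, [/\ 0 <= a, V v, nrm (a%:C%C *: (w - v)) <= 1 &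
    forall v', V v' -> 2^-1 <= nrm (a%:C%C *: (w - v) - v')].
Proof.
move=> sV cV nVw.
pose S : set R := [set nrm (w - v) | v in V].
have S0 : S !=set0 by exists (nrm (w - 0)), 0 => //; exact: subspace0.
have lS : lbound S 0 by move=> _ [v _ <-]; exact: nrm_ge0.
have infS v : V v -> inf S <= nrm (w - v).
  by move=> Vv; apply: ge_inf; [exists 0|exists v].
have d0 : 0 < inf S.
  rewrite lt_neqAle lb_le_inf// andbT eq_sym; apply/eqP => d0; apply: nVw.
  apply: cV => e e0; have [_ [v Vv <-] h] := inf_adherent e0 (conj S0 (ex_intro _ 0 lS)).
  by exists v => //; move: h; rewrite d0 add0r => /ltW.
have [_ [v Vv <-] h] := inf_adherent d0 (conj S0 (ex_intro _ 0 lS)).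
have wv0 : 0 < nrm (w - v) by exact: lt_le_trans (infS _ Vv).
have a0 : 0 <= (nrm (w - v))^-1 by rewrite invr_ge0 nrm_ge0.
exists (nrm (w - v))^-1, v; split=> // [|v' Vv'].
  by rewrite nrmZr// mulVf// gt_eqF.
have -> : (nrm (w - v))^-1%:C%C *: (w - v) - v' =
    (nrm (w - v))^-1%:C%C *: (w - (v + (nrm (w - v))%:C%C *: v')).
  rewrite opprD addrA [RHS]scalerBr scalerA -rmorphM/= mulVf ?gt_eqF//.
  by rewrite scale1r.
rewrite nrmZr// mulrC ler_pdivlMr//.
have Vvv' : V (v + (nrm (w - v))%:C%C *: v').
  by apply: subspaceD => //; exact: subspaceZ.
apply: le_trans (infS _ Vvv'); rewrite mulrC ler_pdivrMr//.
by move: h => /ltW; rewrite mulr_natr mulr2n.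
Qed.

Definition one_plus k (x : X) : X := x + k x.

Lemma bdd_lin_one_plus k : bdd_lin k -> bdd_lin (one_plus k).
Proof. by move=> bk; apply: bdd_linD => //; exact: bdd_lin_id. Qed.

Lemma iter_one_plus k n : cpt_lin k ->
  exists2 k', cpt_lin k' & iter n (one_plus k) = one_plus k'.
Proof.
move=> ck; elim: n => [|n [k' ck' IH]].
  exists (fun=> 0); first exact: cpt_lin0.
  by apply/funext => x; rewrite /one_plus/= addr0.
exists (fun x => k' x + k (one_plus k' x)).
  apply: cpt_linD => //.
  exact: (cpt_lin_compr (bdd_lin_one_plus ck'.1) ck).
by apply/funext => x; rewrite iterS IH /one_plus addrA.
Qed.

Lemma subspace_kernel (f : X -> X) :
  linear f -> linear_subspace [set x | f x = 0].
Proof.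
move=> lf; split=> /= [|a x y fx fy]; first exact: lin0.
by rewrite lf fx fy scaler0 addr0.
Qed.

Lemma closed_kernel (f : X -> X) :
  bdd_lin f -> closed_under_limits [set x | f x = 0].
Proof.
move=> [lf [M [M0 fM]]] x lx; apply/nrm0_eq0/le_small => e e0.
have M1 : 0 < M + 1 by rewrite ltr_wpDl.
have [v fv xv] := lx (e / (M + 1)) (divr_gt0 e0 M1).
rewrite add0r -[f x]subr0 -fv -(linB lf); apply: le_trans (fM _) _.
apply: (@le_trans _ _ ((M + 1) * nrm (x - v))).
  by rewrite ler_wpM2r ?nrm_ge0// lerDl.
by rewrite mulrC -ler_pdivlMr.
Qed.

(** If no finite subset of B is a c-net, every finite subset can be extended by
   a point at distance at least c from it; iterating gives the sequence. *)
Lemma net_or_separated (B : set X) (c : R) :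
  (exists s : seq X, (forall y, y \in s -> B y) /\
     forall x, B x -> exists2 y, y \in s & nrm (x - y) < c) \/
  (exists x : nat -> X, (forall n, B (x n)) /\
     forall n m, (n < m)%N -> c <= nrm (x m - x n)).
Proof.
have [|nonet] := pselect (exists s : seq X, (forall y, y \in s -> B y) /\
  forall x, B x -> exists2 y, y \in s & nrm (x - y) < c); [by left|right].
have /choice[g gP] (s : seq X) : exists x, (forall y, y \in s -> B y) ->
    B x /\ forall y, y \in s -> c <= nrm (x - y).
  have [Bs|nBs] := pselect (forall y, y \in s -> B y); last by exists 0.
  apply: contrapT => h; apply: nonet; exists s; split=> // x Bx.
  apply: contrapT => h'; apply: h; exists x => _; split=> // y ys.
  by rewrite leNgt; apply/negP => xy; apply: h'; exists y.
pose l n := iter n (fun s => rcons s (g s)) [::].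
have Bl n : forall y, y \in l n -> B y.
  elim: n => //= n IH y; rewrite mem_rcons in_cons => /orP[/eqP ->|/IH //].
  by have [] := gP _ IH.
exists (g \o l); split=> [n|n m nm] /=; first by have [] := gP _ (Bl n).
have [_] := gP _ (Bl m); apply; elim: m nm => // m IH.
rewrite ltnS leq_eqVlt => /orP[/eqP ->|/IH h] /=.
  by rewrite mem_rcons mem_head.
by rewrite mem_rcons in_cons h orbT.
Qed.

(** A finite net of the unit ball of the kernel spans it, by successive
   approximation. *)
Lemma kernel_one_plus_dim k : cpt_lin k ->
  exists d, quotient_has_dim [set 0] [set x | one_plus k x = 0] d.
Proof.
move=> ck; have bT := bdd_lin_one_plus ck.1; have [lT _] := bT.
have sN := subspace_kernel lT.
set N := [set x | one_plus k x = 0] in sN *.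
pose B := [set x | N x /\ nrm x <= 1].
have h0 : 0 < 2^-1 :> R by rewrite invr_gt0.
have kN x : N x -> k x = - x.
  by rewrite /N/= /one_plus addrC => /eqP; rewrite addr_eq0 => /eqP.
have [[s [sB net]]|[x [Bx sep]]] := net_or_separated B 2^-1; last first.
  exfalso; apply: (seq_compact_not_separated ck.2 h0 (fun n => (Bx n).2)).
  move=> n m nm; rewrite (kN _ (Bx n).1) (kN _ (Bx m).1) opprK addrC nrmC.
  exact: sep.
pose m := size s; pose y (i : 'I_m) := s`_i.
have Ny i : N (y i) by have [] := sB _ (mem_nth 0 (ltn_ord i)).
pose L (c : bpow (cline (R := R)) m) : X :=
  \sum_i ((c : {ffun 'I_m -> cline (R := R)}) i : R[i]) *: y i.
have bL : bdd_lin L.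
  apply: bdd_lin_sum => i; split=> [a u v|].
    by rewrite !ffunE scalerDl scalerA.
  exists (nrm (y i)); split=> [|c]; first exact: nrm_ge0.
  rewrite nrmZ mulrC ler_wpM2l ?nrm_ge0//.
  exact: (@nrm_bpow_coord _ (cline (R := R))).
have Lsurj x : N x -> exists c, L c = x.
  apply: (approx_surjective (C := 1) bL sN).
    by move=> c; apply: subspace_sum => // i; exact: subspaceZ.
  move=> {}x Nx; have [->|x0] := eqVneq x 0.
    by exists 0; rewrite (lin0 bL.1) subr0 !nrm0 !mulr0.
  have nx0 := nrm_gt0 x0.
  have nV : 0 <= (nrm x)^-1 by rewrite invr_ge0 nrm_ge0.
  have [|y0 ys xy] := net ((nrm x)^-1%:C%C *: x).
    by split; [exact: subspaceZ|rewrite nrmZr// mulVf// gt_eqF].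
  have im : (index y0 s < m)%N by rewrite index_mem.
  pose c : bpow (cline (R := R)) m :=
    [ffun j => if j == Ordinal im then (nrm x)%:C%C else 0].
  have Lc : L c = (nrm x)%:C%C *: y0.
    rewrite /L (bigD1 (Ordinal im))//= big1 => [|j /negbTE ji].
      by rewrite ffunE eqxx addr0 /y/= nth_index.
    by rewrite ffunE ji scale0r.
  exists c; split.
    rewrite mul1r nrm_bpow (bigD1 (Ordinal im))//= big1 => [|j /negbTE ji].
      by rewrite ffunE eqxx addr0 nrm_cline// nrm_ge0.
    by rewrite ffunE ji nrm0.
  rewrite Lc (_ : x - _ = (nrm x)%:C%C *: ((nrm x)^-1%:C%C *: x - y0)).
    by rewrite nrmZr ?nrm_ge0// mulrC ler_wpM2r ?nrm_ge0// ltW.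
  by rewrite scalerBr scalerA -rmorphM/= mulfV ?gt_eqF// scale1r.
pose L' (c : 'rV[R[i]]_m) : X := \sum_i c 0 i *: y i.
have lL' : linear L'.
  move=> a u v; rewrite /L' scaler_sumr -big_split/=; apply: eq_bigr => i _.
  by rewrite !mxE scalerDl scalerA.
have sT : linear_subspace [set: 'rV[R[i]]_m] by [].
have sK : linear_subspace [set c | L' c = 0].
  split=> /= [|a u v u0 v0]; first exact: lin0.
  by rewrite lL' u0 v0 scaler0 addr0.
have dT : quotient_has_dim [set 0] [set: 'rV[R[i]]_m] m.
  apply/quotient_coordP => //; first exact: subspace_set0.
  by exists id; split=> // c; exists c.
have [_ [d [_ Hd]]] := quotient_has_dim_split (subspace_set0 _) sK sT
  (set0_sub sK) (@subsetT _ _) dT.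
exists d.
apply/(quotient_has_dim_map (f := L') (U := [set c | L' c = 0])
  (W := setT)) => //.
- exact: subspace_set0.
- exact: set0_sub.
- exact: lin_on.
- by move=> c _; apply: subspace_sum => // i; exact: subspaceZ.
- move=> x /Lsurj[c <-]; exists (\row_i (c : {ffun _}) i) => //=.
  by apply/eqP; rewrite subr_eq0; apply/eqP/eq_bigr => i _; rewrite mxE.
Qed.

(** Otherwise Riesz's lemma gives x_n in the unit ball of ker T^(n+1), far from
   ker T^n. For n < m, k x_m - k x_n is - x_m modulo ker T^m, so that the images
   k x_n are separated. *)
Lemma ascent k : cpt_lin k -> exists p, forall x,
  iter p.+1 (one_plus k) x = 0 -> iter p (one_plus k) x = 0.
Proof.
move=> ck; apply: contrapT => h; set T := one_plus k in h.
have lT : linear T by have [] := bdd_lin_one_plus ck.1.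
have bTn n : bdd_lin (iter n T).
  by have [k' ck' ->] := iter_one_plus n ck; exact: bdd_lin_one_plus ck'.1.
have T0 : T 0 = 0 by exact: lin0.
have iT0 n m x : (n <= m)%N -> iter n T x = 0 -> iter m T x = 0.
  by move=> /subnK <- xn; rewrite iterD xn; elim: (m - n)%N => //= j ->.
have /choice[x xP] n : exists x, [/\ iter n.+1 T x = 0, nrm x <= 1 &
    forall v, iter n T v = 0 -> 2^-1 <= nrm (x - v)].
  have [w [w0 wn]] : exists w, iter n.+1 T w = 0 /\ iter n T w <> 0.
    apply: contrapT => h'; apply: h; exists n => x x0.
    by apply: contrapT => x0'; apply: h'; exists x.
  have [a [v [_ v0 av dist]]] := riesz_lemma (subspace_kernel (bTn n).1)
    (closed_kernel (bTn n)) wn.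
  exists (a%:C%C *: (w - v)); split=> //.
  rewrite (linZ (bTn _).1) (linB (bTn _).1) w0 (iT0 _ _ _ _ v0)//.
  by rewrite subrr scaler0.
have h0 : 0 < 2^-1 :> R by rewrite invr_gt0.
have x1 n : nrm (x n) <= 1 by case: (xP n).
apply: (seq_compact_not_separated ck.2 h0 x1) => n m nm.
have kE z : k z = T z - z by rewrite /T /one_plus addrAC subrr add0r.
have -> : k (x m) - k (x n) = - (x m - (T (x m) - T (x n) + x n)).
  by rewrite !kE [in LHS]opprB [RHS]opprB [x n - _]addrC addrACA [- x m + _]addrC addrA.
rewrite nrmN; have [xm0 _ d] := xP m; apply: d.
have [xn0 _ _] := xP n.
rewrite (linD (bTn m).1) (linB (bTn m).1) -!iterSr xm0 sub0r.
by rewrite (iT0 _ _ _ _ xn0) 1?ltnW// oppr0 add0r (iT0 _ _ _ _ xn0).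
Qed.

(** Otherwise there are unit vectors z_n far from the kernel with
   z_n + k z_n tending to 0; a cluster point of k z_n yields an element of the
   kernel close to some z_n. *)
Lemma bounded_below_mod_kernel k : cpt_lin k -> exists2 C : R, 0 <= C &
  forall x, exists2 u, one_plus k u = 0 & nrm (x - u) <= C * nrm (one_plus k x).
Proof.
move=> ck; have bT := bdd_lin_one_plus ck.1.
set T := one_plus k in bT *; have [lT [M [M0 TM]]] := bT.
apply: contrapT => h.
have sN := subspace_kernel lT; have cN := closed_kernel bT.
have /choice[z zP] (n : nat) : exists z, [/\ nrm z <= 1, nrm (T z) <= n.+1%:R^-1 &
    forall u, T u = 0 -> 2^-1 <= nrm (z - u)].
  have [w wn] : exists w, forall u, T u = 0 -> n.+1%:R * nrm (T w) < nrm (w - u).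
    apply: contrapT => h'; apply: h; exists n.+1%:R => // x.
    apply: contrapT => h''; apply: h'; exists x => u u0.
    by rewrite ltNge; apply/negP => xu; apply: h''; exists u.
  have nw : ~ [set x | T x = 0] w.
    by move=> /= w0; have := wn _ w0; rewrite w0 subrr !nrm0 mulr0 ltxx.
  have [a [v [a0 /= v0 av dist]]] := riesz_lemma sN cN nw.
  exists (a%:C%C *: (w - v)); split=> //.
  rewrite (linZ lT) (linB lT) v0 subr0 nrmZr//.
  rewrite -[_^-1]mul1r ler_pdivlMr// -mulrA [nrm _ * _]mulrC.
  apply: le_trans av; rewrite nrmZr// ler_wpM2l//.
  exact: ltW (wn _ v0).
have [w kw] := ck.2 z (fun n => (let: And3 a _ _ := zP n in a)).
have near e : 0 < e -> exists n, nrm (z n + w) <= e /\ nrm (T (z n)) <= e.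
  move=> e0; have e2 : 0 < e / 2 by rewrite divr_gt0.
  have [N Ne] := invS_small e2.
  have [n Nn kn] := kw _ e2 N; have [_ Tz _] := zP n.
  have {}Tz : nrm (T (z n)) <= e / 2.
    apply: le_trans Tz _; apply: le_trans (ltW Ne).
    by rewrite lef_pV2 ?posrE// ler_nat ltnS.
  exists n; split; last by apply: le_trans Tz _; lra.
  have -> : z n + w = T (z n) - (k (z n) - w).
    by rewrite /T /one_plus opprB addrCA addrK addrC.
  apply: le_trans (nrmD _ _) _; rewrite nrmN [e]splitr lerD//.
have Tw : T (- w) = 0.
  apply/nrm0_eq0/le_small => e e0; rewrite add0r.
  have M1 : 0 < M + 1 by rewrite ltr_wpDl.
  have [n [zn Tn]] := near (e / (M + 1)) (divr_gt0 e0 M1).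
  have -> : T (- w) = T (z n) - T (z n + w) by rewrite -(linB lT) opprD addrA subrr add0r.
  apply: le_trans (nrmD _ _) _; rewrite nrmN.
  apply: (@le_trans _ _ (e / (M + 1) + M * (e / (M + 1)))).
    by rewrite lerD//; apply: le_trans (TM _) _; rewrite ler_wpM2l.
  by rewrite -[X in X + _]mul1r -mulrDl [1 + M]addrC mulrC divfK ?gt_eqF.
have e4 : 0 < 4^-1 :> R by rewrite invr_gt0.
have [n [zn _]] := near _ e4; have [_ _ d] := zP n.
have := d _ Tw; rewrite opprK => d'.
have := le_trans d' zn; lra.
Qed.

(** A limit of values of T has approximate preimages, and these can be bounded by
   moving them along the kernel, so successive approximation applies. *)
Lemma closed_range k : cpt_lin k -> closed_under_limits (range (one_plus k)).
Proof.
move=> ck; have bT := bdd_lin_one_plus ck.1.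
have [C C0 bb] := bounded_below_mod_kernel ck.
set T := one_plus k in bT bb *; have [lT _] := bT.
move=> x xl.
pose D := [set x | forall e, 0 < e -> exists2 v, range T v & nrm (x - v) <= e].
have sD : linear_subspace D.
  split=> [e e0|a u v Du Dv e e0].
    by exists 0; [exists 0 => //; exact: lin0|rewrite subrr nrm0 ltW].
  have e2 : 0 < e / 2 by rewrite divr_gt0.
  have a1 : 0 < nrm (a : cline) + 1 by rewrite ltr_wpDl// nrm_ge0.
  have [_ [u' _ <-] uu'] := Du _ (divr_gt0 e2 a1).
  have [_ [v' _ <-] vv'] := Dv _ e2.
  exists (T (a *: u' + v')); first by exists (a *: u' + v').
  rewrite lT opprD addrACA -scalerBr; apply: le_trans (nrmD _ _) _.
  rewrite [e]splitr lerD// nrmZ.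
  apply: (@le_trans _ _ ((nrm (a : cline) + 1) * nrm (u - T u'))).
    by rewrite ler_wpM2r ?nrm_ge0// lerDl.
  by rewrite mulrC -ler_pdivlMr.
have [y <-] : exists y, T y = x; last by exists y.
apply: (approx_surjective (C := C * (1 + 2^-1)) bT sD) xl.
  by move=> y e e0; exists (T y); [exists y|rewrite subrr nrm0 ltW].
move=> {}x Dx; have [->|x0] := eqVneq x 0.
  by exists 0; rewrite (lin0 lT) subr0 !nrm0 !mulr0.
have x2 : 0 < 2^-1 * nrm x by rewrite mulr_gt0 ?invr_gt0// nrm_gt0.
have [_ [y _ <-] xy] := Dx _ x2.
have [u u0 yu] := bb y; exists (y - u).
rewrite (linB lT) u0 subr0; split=> //; apply: le_trans yu _.
rewrite -mulrA ler_wpM2l//.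
have := nrm_triangle x (T y) 0; rewrite !subr0 nrmC => h.
by apply: le_trans h _; rewrite mulrDl mul1r addrC lerD2l.
Qed.

(** As for the ascent, with the ranges of the powers of T; these are closed
   because each power is again 1 plus a compact operator. *)
Lemma descent k : cpt_lin k -> exists p, forall x,
  exists y, iter p (one_plus k) x = iter p.+1 (one_plus k) y.
Proof.
move=> ck; apply: contrapT => h; set T := one_plus k in h.
have lT : linear T by have [] := bdd_lin_one_plus ck.1.
have bTn n : bdd_lin (iter n T).
  by have [k' ck' ->] := iter_one_plus n ck; exact: bdd_lin_one_plus ck'.1.
have cTn n : closed_under_limits (range (iter n T)).
  by have [k' ck' ->] := iter_one_plus n ck; exact: closed_range.
have sTn n : linear_subspace (range (iter n T)).
  split; first by exists 0 => //; exact: (lin0 (bTn n).1).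
  by move=> a _ _ [u _ <-] [v _ <-]; exists (a *: u + v) => //; exact: (bTn n).1.
have iR n m x : (n <= m)%N -> range (iter m T) x -> range (iter n T) x.
  move=> /subnKC <- [y _ <-]; rewrite iterD.
  by exists (iter (m - n)%N T y).
have /choice[x xP] n : exists x, [/\ range (iter n T) x, nrm x <= 1 &
    forall v, range (iter n.+1 T) v -> 2^-1 <= nrm (x - v)].
  have [w nw] : exists w, ~ range (iter n.+1 T) (iter n T w).
    apply: contrapT => h'; apply: h; exists n => w.
    apply: contrapT => h''; apply: h'; exists w => -[y _ e].
    by apply: h''; exists y.
  have [a [v [_ Rv av dist]]] := riesz_lemma (sTn _) (cTn _) nw.
  exists (a%:C%C *: (iter n T w - v)); split=> //.
  apply: subspaceZ => //; apply: subspaceB => //.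
  exact: iR Rv.
have h0 : 0 < 2^-1 :> R by rewrite invr_gt0.
have x1 n : nrm (x n) <= 1 by case: (xP n).
apply: (seq_compact_not_separated ck.2 h0 x1) => n m nm.
have kE z : k z = T z - z by rewrite /T /one_plus addrAC subrr add0r.
have -> : k (x m) - k (x n) = x n - (T (x n) - T (x m) + x m).
  rewrite !kE [in LHS]opprB [LHS]addrC [LHS]addrA [in RHS]opprD [in RHS]opprB.
  by rewrite [RHS]addrA; congr (_ - _); rewrite [RHS]addrA [RHS]addrAC.
have [Rn _ d] := xP n; apply: d.
have [Rm _ _] := xP m.
have RT j z : range (iter j T) z -> range (iter j.+1 T) (T z).
  by move=> [y _ <-]; exists y.
apply: subspaceD; [exact: sTn| |exact: iR Rm].
apply: subspaceB; [exact: sTn|exact: RT|].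
by apply: iR (RT _ _ Rm); rewrite ltnS ltnW.
Qed.

(** With m beyond ascent and descent and N = ker T^m, X / TX = N / TN, and
   T induces N / ker T = TN. *)
Lemma index_one_plus_compact k : cpt_lin k ->
  exists d, has_dims (one_plus k) setT setT d d.
Proof.
move=> ck; have [p asc] := ascent ck; have [q desc] := descent ck.
have [lT _] := bdd_lin_one_plus ck.1.
set T := one_plus k in asc desc lT *.
pose m := (maxn p q).+1.
have ascn j x : iter (p + j).+1 T x = 0 -> iter p T x = 0.
  elim: j x => [|j IH] x; first by rewrite addn0; exact: asc.
  by rewrite addnS iterSr => /IH; rewrite -iterSr; exact: asc.
have ascm x : iter m.+1 T x = 0 -> iter m T x = 0.
  have -> : m.+1 = (p + (m - p)).+1 by rewrite subnKC// ltnW// ltnS leq_maxl.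
  move=> /ascn xp; rewrite -(subnK (_ : p <= m)%N); last by rewrite ltnW// ltnS leq_maxl.
  by rewrite iterD xp; elim: (m - p)%N => //= j ->; exact: lin0.
have descn j x : exists y, iter q T x = iter (q + j) T y.
  elim: j => [|j [y ->]]; first by exists x; rewrite addn0.
  rewrite addnC iterD; have [z ->] := desc y; exists z.
  by rewrite -iterD; congr (iter _ _ _); lia.
have descm x : exists y, iter m T x = iter m T (iter m T y).
  have em : (m - q + q)%N = m by rewrite subnK// ltnW// ltnS leq_maxr.
  have [y e] := descn m x; exists y.
  by rewrite -iterD -{1}em iterD e -iterD; congr (iter _ _ _); lia.
have [k' ck' eT] := iter_one_plus m ck.
have [n] := kernel_one_plus_dim ck'; rewrite -eT -/T => dN.
have lTm : linear (iter m T) by rewrite eT; have [] := bdd_lin_one_plus ck'.1.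
have sN := subspace_kernel lTm; set N := [set x | _] in sN dN.
have sK := subspace_kernel lT; set Kr := [set x | _] in sK.
have sT : linear_subspace [set: X] by [].
have mT : linear_map_on setT setT T by split=> // a x y _ _; exact: lT.
have mTN : linear_map_on N N T.
  split=> [a x y _ _|x]; first exact: lT.
  by rewrite /N/= -iterSr iterS => ->; exact: lin0.
have sTN := image_subspace sN mTN; have sTX := image_subspace sT mT.
have KN : Kr `<=` N.
  move=> x Tx; have -> : N x = (iter m T x = 0) by [].
  rewrite /m iterSr (_ : T x = 0)//; by elim: (maxn p q) => //= j ->; exact: lin0.
have TNN := linear_image_sub mTN.
have [a [b [Ha Hb]]] :=
  quotient_has_dim_split (subspace_set0 X) sK sN (set0_sub sK) KN dN.
have [b' [c [Hb' Hc]]] :=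
  quotient_has_dim_split (subspace_set0 X) sTN sN (set0_sub sTN) TNN dN.
have nab : n = (a + b)%N.
  apply: (quotient_has_dim_uniq (subspace_set0 X) sN (set0_sub sN) dN).
  exact: (quotient_has_dimD (subspace_set0 X) sK sN (set0_sub sK) KN Ha Hb).
have nbc : n = (b' + c)%N.
  apply: (quotient_has_dim_uniq (subspace_set0 X) sN (set0_sub sN) dN).
  exact: (quotient_has_dimD (subspace_set0 X) sTN sN (set0_sub sTN) TNN Hb' Hc).
have bb' : b = b'.
  apply: (quotient_has_dim_uniq (subspace_set0 X) sTN (set0_sub sTN)) Hb'.
  apply/(quotient_has_dim_map (f := T) (U := Kr) (W := N)) => //.
  - exact: subspace_set0.
  - exact: set0_sub.
  - by move=> l x y _ _; exact: lT.
  - by move=> _ [x Nx <-]; exists x; rewrite ?subrr.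
exists a; split.
  have -> : kernel_in T setT = Kr by apply/seteqP; split=> [x []|x].
  by [].
have -> : a = c by lia.
apply/(quotient_has_dim_map (f := id) (U := T @` N) (W := N)) => //.
- move=> x Nx; split=> [[y _ yx]|[y Ny <-]]; last by exists y.
  exists y => //; apply: ascm; rewrite iterSr yx; exact: Nx.
- move=> x _; have [y xy] := descm x; exists (x - iter m T y).
    by change (iter m T (x - iter m T y) = 0); rewrite (linB lTm) xy subrr.
  by rewrite subKr; exists (iter m.-1 T y).
Qed.

(** B = 1 + A satisfies |x| <= 2 |B x|, and x is itself an approximate preimage
   of x under B. *)
Lemma bijective_one_plus_small (A : X -> X) : bdd_lin A ->
  (forall x, nrm (A x) <= 2^-1 * nrm x) ->
  exists g, [/\ bdd_lin g, cancel g (one_plus A) & cancel (one_plus A) g].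
Proof.
move=> bA sA; have bB := bdd_lin_one_plus bA; set B := one_plus A in bB *.
have below x : nrm x <= 2 * nrm (B x).
  have := nrm_triangle (- A x) x 0; rewrite !subr0 opprK -/(B x) nrmN.
  by have := sA x; lra.
have /choice[g gP] x : exists y, B y = x.
  apply: (approx_surjective (D := setT) (C := 1) bB) => // {}x _; exists x.
  by rewrite mul1r /B /one_plus opprD addrA subrr add0r nrmN.
have Binj x y : B x = B y -> x = y.
  move=> e; apply/eqP; rewrite -subr_eq0; apply/eqP/nrm0_eq0.
  by have := below (x - y); rewrite (linB bB.1) e subrr nrm0 mulr0.
exists g; split=> //; last by move=> x; exact: Binj.
split=> [a x y|]; first by apply: Binj; rewrite bB.1 !gP.
by exists 2; split=> // x; rewrite -[X in _ <= _ * nrm X]gP.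
Qed.

(** 1 + A + k = (1 + A) (1 + (1 + A)^-1 k). *)
Lemma index_one_plus_small_compact (A k : X -> X) : bdd_lin A ->
  (forall x, nrm (A x) <= 2^-1 * nrm x) -> cpt_lin k ->
  exists d, has_dims (one_plus (fun x => A x + k x)) setT setT d d.
Proof.
move=> bA sA ck; have [g [bg gK Kg]] := bijective_one_plus_small bA sA.
have cgk : cpt_lin (g \o k) by exact: cpt_lin_compl.
have [d Hd] := index_one_plus_compact cgk.
have bB := bdd_lin_one_plus bA.
have sT : linear_subspace [set: X] by [].
have mT (f : X -> X) : linear f -> linear_map_on setT setT f.
  by move=> lf; split=> // a x y _ _; exact: lf.
exists d; refine (proj1 (has_dims_conj (u := id) (v := one_plus A)
  d d sT sT sT sT _ _ _ _ _) Hd) => //.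
- by apply: mT; have [] := bdd_lin_one_plus cgk.1.
- by apply: mT; have [] := bdd_lin_one_plus (bdd_linD bA ck.1).
- by split=> //; move=> y _; exists y.
- split=> [|x _ Bx|y _]; first by apply: mT; case: bB.
    by rewrite -[x]Kg Bx; exact: (lin0 bg.1).
  by exists (g y) => //; exact: gK.
- move=> x _; rewrite {2}/one_plus (linD bB.1) /= gK /one_plus addrA.
  by rewrite addrAC.
Qed.

(** The operator 1 + C on X and its restriction to a subspace D containing the
   range of C have the same kernel and the same cokernel. *)
Lemma index_restriction (D : set X) (G A k : X -> X) :
  linear_subspace D -> bdd_lin A ->
  (forall x, nrm (A x) <= 2^-1 * nrm x) -> cpt_lin k ->
  (forall x, D (A x + k x)) -> (forall x, D x -> G x = x + (A x + k x)) ->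
  exists d, has_dims G D D d d.
Proof.
move=> sD bA sA ck DC GE.
have [d [Hk Hc]] := index_one_plus_small_compact bA sA ck.
pose T := one_plus (fun x => A x + k x); rewrite -/T in Hk Hc.
have [lT _] := bdd_lin_one_plus (bdd_linD bA ck.1).
have sT : linear_subspace [set: X] by [].
have mT : linear_map_on setT setT T by split=> // a x y _ _; exact: lT.
have mG : linear_map_on D D G.
  split=> [a x y Dx Dy|x Dx]; last by rewrite GE//; exact: subspaceD.
  rewrite !GE//; [exact: lT|].
  by apply: subspaceD => //; exact: subspaceZ.
have DT x : D (T x) -> D x.
  by move=> DTx; rewrite -[x](addrK (A x + k x)); exact: subspaceB.
have TG x : D x -> T x = G x by move=> Dx; rewrite GE.
exists d; split.
  suff -> : kernel_in G D = kernel_in T setT by [].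
  apply/seteqP; split=> x [Dx Gx]; first by split=> //; rewrite TG.
  have Dx' : D x by apply: DT; rewrite Gx; exact: subspace0.
  by split=> //; rewrite -TG.
apply/(quotient_has_dim_map (f := id) (U' := T @` setT) (W' := setT)) => //.
- exact: image_subspace mG.
- exact: linear_image_sub.
- exact: image_subspace mT.
- move=> y Dy; split=> [[x _ xy]|[x Dx <-]]; last by exists x => //; rewrite TG.
  have Dx : D x by apply: DT; rewrite xy.
  by exists x => //; rewrite -TG.
- move=> x _; exists (- (A x + k x)); first exact: subspaceN.
  by rewrite opprK; exists x.
Qed.

End Riesz.

(** * Operator matrices and corners *)

Section OperatorMatrices.
Context {R : realType}.
Implicit Types X Y : completeNormedModType R[i].

Definition bpow_coord X n (j : 'I_n) (x : bpow X n) : X :=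
  (x : {ffun 'I_n -> X}) j.

Definition bpow_inj X n (i : 'I_n) (x : X) : bpow X n :=
  [ffun j => if j == i then x else 0].

Definition opmx X Y m n (k : 'I_m -> 'I_n -> X -> Y) (x : bpow X n) :
    bpow Y m :=
  [ffun i => \sum_j k i j (bpow_coord j x)].

Lemma bpowP X n (x y : bpow X n) :
  (forall i, bpow_coord i x = bpow_coord i y) -> x = y.
Proof. by move=> xy; apply/ffunP. Qed.

Lemma linear_bpow_coord X n (j : 'I_n) : linear (@bpow_coord X n j).
Proof. by move=> k x y; rewrite /bpow_coord !ffunE. Qed.

Lemma bdd_bpow_coord X n (j : 'I_n) : bdd_lin (@bpow_coord X n j).
Proof.
split; first exact: linear_bpow_coord.
by exists 1; split=> // x; rewrite mul1r nrm_bpow_coord.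
Qed.

Lemma bdd_bpow_inj X n (i : 'I_n) : bdd_lin (@bpow_inj X n i).
Proof.
split=> [k x y|].
  apply: bpowP => j; rewrite (linear_bpow_coord j) /bpow_coord !ffunE.
  by case: eqP => _; rewrite ?scaler0 ?addr0.
exists 1; split=> // x; rewrite mul1r nrm_bpow (bigD1 i)//= big1.
  by rewrite ffunE eqxx addr0.
by move=> j /negbTE ji; rewrite ffunE ji nrm0.
Qed.

Lemma bpow_coord_sum X n m (f : 'I_m -> bpow X n) j :
  bpow_coord j (\sum_i f i) = \sum_i bpow_coord j (f i).
Proof.
apply: (big_morph (bpow_coord j)) => [x y|]; last by rewrite /bpow_coord ffunE.
by rewrite /bpow_coord ffunE.
Qed.

Lemma opmx_sum X Y m n (k : 'I_m -> 'I_n -> X -> Y) :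
  opmx k =
  fun x => \sum_i \sum_j (@bpow_inj Y m i \o (k i j \o @bpow_coord X n j)) x.
Proof.
apply/funext => x; apply: bpowP => l.
rewrite {1}/bpow_coord ffunE bpow_coord_sum [RHS](bigD1 l)//=.
rewrite [X in _ = _ + X]big1 ?addr0.
  rewrite bpow_coord_sum; apply: eq_bigr => j _.
  by rewrite [RHS]ffunE eqxx.
move=> i il; rewrite bpow_coord_sum big1// => j _.
by rewrite {1}/bpow_coord ffunE eq_sym (negbTE il).
Qed.

Lemma bdd_opmx X Y m n (k : 'I_m -> 'I_n -> X -> Y) :
  (forall i j, bdd_lin (k i j)) -> bdd_lin (opmx k).
Proof.
move=> bk; rewrite opmx_sum; apply: bdd_lin_sum => i; apply: bdd_lin_sum => j.
exact: (bdd_lin_comp (bdd_lin_comp (bdd_bpow_coord X j) (bk i j))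
  (bdd_bpow_inj Y i)).
Qed.

Lemma cpt_opmx X Y m n (k : 'I_m -> 'I_n -> X -> Y) :
  (forall i j, cpt_lin (k i j)) -> cpt_lin (opmx k).
Proof.
move=> ck; rewrite opmx_sum; apply: cpt_lin_sum => i; apply: cpt_lin_sum => j.
exact: (cpt_lin_compl (cpt_lin_compr (bdd_bpow_coord X j) (ck i j))
  (bdd_bpow_inj Y i)).
Qed.

Definition amp_fun X Y n (f : X -> Y) (x : bpow X n) : bpow Y n :=
  [ffun i => f (bpow_coord i x)].

Lemma amp_funE X Y n (f : X -> Y) (x : bpow X n) i :
  bpow_coord i (amp_fun f x) = f (bpow_coord i x).
Proof. by rewrite {1}/bpow_coord ffunE. Qed.

Lemma opmxE X Y m n (k : 'I_m -> 'I_n -> X -> Y) x i :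
  bpow_coord i (opmx k x) = \sum_j k i j (bpow_coord j x).
Proof. by rewrite {1}/bpow_coord ffunE. Qed.

Lemma amp_fun_opmx X Y n (f : X -> Y) :
  @amp_fun X Y n f = opmx (fun i j => if i == j then f else fun=> 0).
Proof.
apply/funext => x; apply: bpowP => i; rewrite amp_funE opmxE.
rewrite (bigD1 i)//= eqxx big1 ?addr0// => j.
by rewrite eq_sym => /negbTE ->.
Qed.

Lemma bdd_amp_fun X Y n (f : X -> Y) : bdd_lin f -> bdd_lin (@amp_fun X Y n f).
Proof.
move=> bf; rewrite amp_fun_opmx; apply: bdd_opmx => i j.
by case: eqP => // _; exact: bdd_lin0.
Qed.

Lemma cpt_amp_fun X Y n (f : X -> Y) : cpt_lin f -> cpt_lin (@amp_fun X Y n f).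
Proof.
move=> bf; rewrite amp_fun_opmx; apply: cpt_opmx => i j.
by case: eqP => // _; exact: cpt_lin0.
Qed.

Lemma cpt_lin_op X Y (f : X -> Y) : bdd_lin f -> compact_op f -> cpt_lin f.
Proof. by move=> bf cf; split=> //; exact: seq_compact_op. Qed.

End OperatorMatrices.

Section Corners.
Context {R : realType} {A : unitalAlg R[i]} {G : graded_rep A}.
Local Notation X := (gr_space G).

Definition amp m n (v : 'M[A]_(m, n)) : bpow X n -> bpow X m :=
  opmx (fun i j => gr_rep G (v i j)).

Lemma bdd_amp m n (v : 'M[A]_(m, n)) : bdd_lin (amp v).
Proof. by apply: bdd_opmx => i j; apply/bdd_lin_op/gr_rep_bounded. Qed.

Lemma gr_rep0 x : gr_rep G 0 x = 0.
Proof. by apply: (addrI (gr_rep G 0 x)); rewrite -gr_repD !addr0. Qed.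

Lemma gr_rep_sum n (a : 'I_n -> A) x :
  gr_rep G (\sum_i a i) x = \sum_i gr_rep G (a i) x.
Proof.
apply: (big_morph (fun a => gr_rep G a x)) => [b c|]; first exact: gr_repD.
exact: gr_rep0.
Qed.

Lemma ampM m n p (v : 'M[A]_(m, n)) (w : 'M[A]_(n, p)) x :
  amp (v *m w) x = amp v (amp w x).
Proof.
apply: bpowP => i; rewrite !opmxE.
under eq_bigr do rewrite mxE gr_rep_sum.
rewrite exchange_big/=; apply: eq_bigr => j _.
rewrite opmxE linear_sum; apply: eq_bigr => l _.
by rewrite gr_repM.
Qed.

Notation gam := (amp_fun (gr_gamma G)).

Lemma bdd_gam n : bdd_lin (@amp_fun _ X X n (gr_gamma G)).
Proof. by apply/bdd_amp_fun/bdd_lin_op/gr_gamma_bounded. Qed.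

Lemma amp_gam m n (v : 'M[A]_(m, n)) x : amp v (gam x) = gam (amp v x).
Proof.
apply: bpowP => i; rewrite amp_funE !opmxE linear_sum/=.
by apply: eq_bigr => j _; rewrite amp_funE gr_rep_gamma.
Qed.

Lemma gamK n (x : bpow X n) : gam (gam x) = x.
Proof. by apply: bpowP => i; rewrite !amp_funE gr_gammaK. Qed.

(** For s = 1 and s = -1 these are e_n (X_+^n) and e_n (X_-^n). Keeping s as a
   parameter lets each lemma serve both F_+ and F_-. *)
Definition corner n (e : 'M[A]_n) (s : R[i]) : set (bpow X n) :=
  [set x | amp e x = x /\ gam x = s *: x].

Lemma corner_subspace n (e : 'M[A]_n) s : linear_subspace (corner e s).
Proof.
have le := (bdd_amp e).1; have lg := (bdd_gam n).1.
split=> [|k x y [ex gx] [ey gy]].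
  by split; [exact: lin0|rewrite (lin0 lg) scaler0].
by split; rewrite ?le ?lg ?ex ?ey// gx gy scalerDr !scalerA mulrC.
Qed.

Definition corner_proj n (e : 'M[A]_n) (s : R[i]) (x : bpow X n) : bpow X n :=
  amp e (2^-1 *: (x + s *: gam x)).

Lemma bdd_corner_proj n (e : 'M[A]_n) s : bdd_lin (corner_proj e s).
Proof.
apply: (bdd_lin_comp (f := fun x => 2^-1 *: (x + s *: gam x)) _ (bdd_amp e)).
apply: bdd_linZ; apply: bdd_linD; first exact: bdd_lin_id.
by apply: bdd_linZ; exact: bdd_gam.
Qed.

Lemma corner_proj_in n (e : 'M[A]_n) s x : e *m e = e -> s * s = 1 ->
  corner e s (corner_proj e s x).
Proof.
move=> ee ss; have lg := (bdd_gam n).1.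
split; first by rewrite /corner_proj -ampM ee.
rewrite /corner_proj -amp_gam (linZ lg) (linD lg) (linZ lg) gamK.
rewrite -(linZ (bdd_amp e).1) [in RHS]scalerA [s * _]mulrC -[in RHS]scalerA.
by rewrite [in RHS]scalerDr scalerA ss scale1r [in RHS]addrC.
Qed.

Lemma two_halves (V : lmodType R[i]) (x : V) : 2^-1 *: (x + x) = x.
Proof. by rewrite -mulr2n -[x *+ 2]scaler_nat scalerA mulVf ?scale1r// pnatr_eq0. Qed.

Lemma corner_projE n (e : 'M[A]_n) s x : s * s = 1 -> corner e s x ->
  corner_proj e s x = x.
Proof.
by move=> ss [ex gx]; rewrite /corner_proj gx scalerA ss scale1r two_halves.
Qed.

Lemma even_partE x : even_part G x <-> gr_gamma G x = 1 *: x.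
Proof.
rewrite scale1r; split=> [[y _ <-]|gx].
  by rewrite linearZ linearD/= gr_gammaK addrC.
by exists x => //; rewrite gx two_halves.
Qed.

Lemma odd_partE x : odd_part G x <-> gr_gamma G x = -1 *: x.
Proof.
rewrite scaleN1r; split=> [[y _ <-]|gx].
  by rewrite linearZ linearB/= gr_gammaK -scalerN opprB.
by exists x => //; rewrite gx opprK two_halves.
Qed.

Lemma image_corner n (e : 'M[A]_n) s (P : set (bpow X n)) : e *m e = e ->
  (forall x, P x <-> gam x = s *: x) -> amp_rep G e @` P = corner e s.
Proof.
move=> ee PE; apply/seteqP; split=> [_ [x /PE gx <-]|x [ex gx]].
  split; first by rewrite -[amp_rep G e x]/(amp e x) -ampM ee.
  by rewrite -[amp_rep G e x]/(amp e x) -amp_gam gx (linZ (bdd_amp e).1).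
by exists x; [exact/PE|exact: ex].
Qed.

Lemma gam_eigenP n s (x : bpow X n) :
  gam x = s *: x <->
  forall i, gr_gamma G (bpow_coord i x) = s *: bpow_coord i x.
Proof.
split=> [gx i|gx].
  by rewrite -amp_funE gx -(linZ (@linear_bpow_coord _ X n i)).
apply: bpowP => i.
by rewrite amp_funE gx -(linZ (@linear_bpow_coord _ X n i)).
Qed.

End Corners.

Arguments amp {R A} G {m n} v x.
Arguments corner {R A} G {n} e s _.
Arguments corner_proj {R A} G {n} e s x.

Section ModuleCorners.
Context {R : realType} {A : unitalAlg R[i]}.

Lemma corner_evenE (M : fredholm_module A) n (e : 'M[A]_n) : e *m e = e ->
  corner_even M e = corner M e 1.
Proof.
move=> ee; apply: image_corner => // x; rewrite gam_eigenP.
by split=> h i; apply/even_partE/h.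
Qed.

Lemma corner_oddE (M : fredholm_module A) n (e : 'M[A]_n) : e *m e = e ->
  corner_odd M e = corner M e (-1).
Proof.
move=> ee; apply: image_corner => // x; rewrite gam_eigenP.
by split=> h i; apply/odd_partE/h.
Qed.

End ModuleCorners.

(** * Compressions and their parametrices *)

Section Compressions.
Context {R : realType} {A : unitalAlg R[i]} {G : graded_rep A}.
Local Notation X := (gr_space G).
Implicit Types F : fredholm_op G.

Definition compress F n (e : 'M[A]_n) (x : bpow X n) : bpow X n :=
  amp G e (amp_op F n (amp G e x)).

Lemma fo_cpt_sqr F : cpt_lin (fun x => F (F x) - x).
Proof.
apply: cpt_lin_op (@fo_sqr _ _ _ F); apply: bdd_linB; last exact: bdd_lin_id.
by apply: (bdd_lin_comp (f := F)); apply/bdd_lin_op/fo_bounded.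
Qed.

Lemma fo_cpt_comm F a : cpt_lin (fun x => F (gr_rep G a x) - gr_rep G a (F x)).
Proof.
apply: cpt_lin_op (@fo_comm _ _ _ F a).
have bF := bdd_lin_op (@fo_bounded _ _ _ F).
have bA : bdd_lin (gr_rep G a) by apply/bdd_lin_op/gr_rep_bounded.
by apply: bdd_linB; [exact: (bdd_lin_comp bA bF)|exact: (bdd_lin_comp bF bA)].
Qed.

Lemma bdd_amp_op F n : bdd_lin (amp_op F n).
Proof. by apply: bdd_amp_fun; exact/bdd_lin_op/fo_bounded. Qed.

Lemma amp_opE F n x i : bpow_coord i (amp_op F n x) = F (bpow_coord i x).
Proof. exact: amp_funE. Qed.

Lemma amp_op_sqr F n : cpt_lin (fun x => amp_op F n (amp_op F n x) - x).
Proof.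
have := cpt_amp_fun n (fo_cpt_sqr F); congr cpt_lin; apply/funext => x.
apply: bpowP => i; rewrite amp_funE (linB (@linear_bpow_coord _ X _ i)).
by rewrite !amp_opE.
Qed.

Lemma amp_op_comm F m n (v : 'M[A]_(m, n)) :
  cpt_lin (fun x => amp_op F m (amp G v x) - amp G v (amp_op F n x)).
Proof.
have := cpt_opmx (fun i j => fo_cpt_comm F (v i j)).
congr cpt_lin; apply/funext => x; apply: bpowP => i.
rewrite (linB (@linear_bpow_coord _ X _ i)) amp_opE !opmxE linear_sum -sumrB.
by apply: eq_bigr => j _; rewrite amp_opE.
Qed.

Notation gam := (amp_fun (gr_gamma G)).

Lemma amp_op_gam F n x : amp_op F n (gam x) = - gam (amp_op F n x).
Proof.
apply: bpowP => i; rewrite (linN (@linear_bpow_coord _ X _ i)).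
by rewrite amp_opE !amp_funE fo_odd.
Qed.

Lemma bdd_compress F n (e : 'M[A]_n) : bdd_lin (compress F e).
Proof.
exact: (bdd_lin_comp (bdd_lin_comp (bdd_amp e) (bdd_amp_op F n)) (bdd_amp e)).
Qed.

Lemma corner_map n (e : 'M[A]_n) s (U : bpow X n -> bpow X n) :
  linear U -> (forall x, amp G e (U x) = U x) ->
  (forall x, U (gam x) = - gam (U x)) ->
  linear_map_on (corner G e s) (corner G e (- s)) U.
Proof.
move=> lU eU gU; split; first exact: lin_on.
move=> x [ex gx]; split; first exact: eU.
by rewrite scaleNr -(linZ lU) -gx gU opprK.
Qed.

Lemma compress_map F n (e : 'M[A]_n) s : e *m e = e ->
  linear_map_on (corner G e s) (corner G e (- s)) (compress F e).
Proof.
move=> ee; apply: corner_map => [|x|x]; first by case: (bdd_compress F e).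
  by rewrite /compress -ampM ee.
rewrite /compress amp_gam amp_op_gam (linN (bdd_amp e).1) amp_gam.
by [].
Qed.

(** Composing with the projection onto the corner extends W - 1 to an operator on
   the whole space with range in the corner. *)
Lemma index_corner n (e : 'M[A]_n) s (W A' k : bpow X n -> bpow X n) :
  e *m e = e -> s * s = 1 -> linear_map_on (corner G e s) (corner G e s) W ->
  bdd_lin A' -> (forall x, nrm (A' (corner_proj G e s x)) <= 2^-1 * nrm x) ->
  cpt_lin k -> (forall x, corner G e s x -> W x = x + (A' x + k x)) ->
  exists d, has_dims W (corner G e s) (corner G e s) d d.
Proof.
move=> ee ss [_ WD] bA sA ck WE.
have bP := bdd_corner_proj (G := G) e s.
have sD := corner_subspace (G := G) e s.
apply: (index_restriction sD (A := A' \o corner_proj G e s)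
  (k := k \o corner_proj G e s)) => //=.
- exact: bdd_lin_comp bP bA.
- exact: cpt_lin_compr bP ck.
- move=> x; set y := corner_proj G e s x.
  have Dy : corner G e s y by exact: corner_proj_in.
  have -> : A' y + k y = W y - y by rewrite WE// addrAC subrr add0r.
  by apply: subspaceB => //; exact: WD.
- by move=> x Dx; rewrite (corner_projE ss Dx) WE.
Qed.

(** U is e_n F up to a compact and a small operator, so that the compression
   of F, used in both directions, inverts it up to such operators. *)
Lemma compress_parametrix F n (e : 'M[A]_n) : e *m e = e ->
  exists2 delta : R, 0 < delta & forall U k A' : bpow X n -> bpow X n,
    bdd_lin A' -> (forall x, nrm (A' x) <= delta * nrm x) -> cpt_lin k ->
    (forall x, amp G e (U x) = U x) -> (forall x, U (gam x) = - gam (U x)) ->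
    (forall x, U x = amp G e (amp_op F n x) + (A' x + k x)) ->
    forall s, s * s = 1 ->
    (exists d, has_dims (compress F e \o U) (corner G e s)
      (corner G e s) d d) /\
    (exists d, has_dims (U \o compress F e) (corner G e s) (corner G e s) d d).
Proof.
move=> ee; have bS := bdd_compress F e; have be := bdd_amp (G := G) e.
have bF := bdd_amp_op F n.
have [lS [c [c0 Sc]]] := bS; have [le _] := be; have [lF _] := bF.
have [_ [p [p0 Pp]]] := bdd_corner_proj (G := G) e 1.
have [_ [p' [p'0 P'p]]] := bdd_corner_proj (G := G) e (-1).
pose q := p + p'.
have q0 : 0 <= q by rewrite addr_ge0.
have cq1 : 0 < c * q + 1 by rewrite ltr_wpDl// mulr_ge0.
exists (2^-1 / (c * q + 1)); first by rewrite divr_gt0 ?invr_gt0.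
move=> U k A' bA sA ck eU gU UE s ss.
have sE : s = 1 \/ s = -1.
  have : (s - 1) * (s + 1) == 0 by rewrite -subr_sqr expr2 ss expr1n subrr.
  by rewrite mulf_eq0 => /orP[]; [rewrite subr_eq0 => /eqP; left|
    rewrite addr_eq0 => /eqP; right].
have {Pp P'p} Pq x : nrm (corner_proj G e s x) <= q * nrm x.
  by case: sE => ->; [apply: le_trans (Pp x) _|apply: le_trans (P'p x) _];
    rewrite ler_wpM2r ?nrm_ge0// ?lerDl ?lerDr.
have h0 : 0 <= 2^-1 :> R by rewrite invr_ge0.
have small (x : bpow X n) : 2^-1 / (c * q + 1) * (c * (q * nrm x)) <= 2^-1 * nrm x.
  have -> : 2^-1 / (c * q + 1) * (c * (q * nrm x)) =
      (c * q / (c * q + 1)) * (2^-1 * nrm x) by ring.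
  rewrite ler_piMl//; first by rewrite mulr_ge0// nrm_ge0.
  by rewrite ler_pdivrMr// mul1r lerDl.
have d0 : 0 <= 2^-1 / (c * q + 1) by rewrite divr_ge0// ltW.
have bU : bdd_lin U.
  rewrite (_ : U = fun x => amp G e (amp_op F n x) + (A' x + k x)); last exact/funext.
  by apply: bdd_linD; [exact: (bdd_lin_comp bF be)|exact: bdd_linD ck.1].
have mS t := compress_map F t ee.
have mU t := corner_map (e := e) t bU.1 eU gU.
(* The compact part of e F e F on the range of e. *)
pose k0 x := amp G e (amp_op F n (amp_op F n x) - x) +
  amp G e (amp_op F n (amp G e (amp_op F n x) - amp_op F n (amp G e x))).
have ck0 : cpt_lin k0.
  apply: cpt_linD; first exact: (cpt_lin_compl (amp_op_sqr F n) be).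
  have h := cpt_linZ (-1) (amp_op_comm F e).
  have := cpt_lin_compl (cpt_lin_compl h bF) be.
  by congr cpt_lin; apply/funext => x /=; rewrite scaleN1r opprB.
have eFeF x : amp G e x = x ->
    amp G e (amp_op F n (amp G e (amp_op F n x))) = x + k0 x.
  move=> ex; rewrite /k0 ex (linB lF) !(linB le) ex.
  by rewrite addrA [x + _]addrC subrK addrC subrK.
split.
- apply: (index_corner (A' := fun x => compress F e (A' x))
    (k := fun x => k0 x + compress F e (k x))) => //.
  + by apply: linear_map_on_comp (mU s) _; have := mS (- s); rewrite opprK.
  + exact: bdd_lin_comp bA bS.
  + move=> x; apply: le_trans (Sc _) _. apply: le_trans _ (small x).
    rewrite mulrCA ler_wpM2l//; apply: le_trans (sA _) _.
    by rewrite ler_wpM2l.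
  + by apply: cpt_linD => //; exact: cpt_lin_compl ck bS.
  + move=> x [ex _] /=.
    rewrite UE (linD lS) (linD lS) {1}/compress -ampM ee eFeF//.
    by rewrite -addrA; congr (x + _); rewrite addrCA.
- apply: (index_corner (A' := fun x => A' (compress F e x))
    (k := fun x => k0 x + k (compress F e x))) => //.
  + by have := linear_map_on_comp (mS s) (mU (- s)); rewrite opprK.
  + exact: bdd_lin_comp bS bA.
  + move=> x; apply: le_trans (sA _) _; apply: le_trans _ (small x).
    rewrite ler_wpM2l//; apply: le_trans (Sc _) _.
    by rewrite ler_wpM2l.
  + by apply: cpt_linD => //; exact: cpt_lin_compr bS ck.
  + move=> x [ex _] /=.
    rewrite UE {1}/compress ex eFeF//.
    by rewrite -addrA; congr (x + _); rewrite addrCA.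
Qed.

(** The maps e F e and v F' w have the common parametrix e F e, because
   v F' w = e F' = e F modulo compact operators and an operator of norm
   proportional to that of F' - F; and v F' w is conjugate to f F' f through v
   and w. *)
Lemma index_compress F n m (e : 'M[A]_n) (f : 'M[A]_m) (v : 'M[A]_(n, m))
    (w : 'M[A]_(m, n)) :
  e *m e = e -> f *m f = f -> v *m w = e -> w *m v = f ->
  exists2 delta : R, 0 < delta & forall F' : fredholm_op G,
    (forall x, nrm (F' x - F x) <= delta * nrm x) ->
    exists p q p' q',
      [/\ has_dims (compress F e) (corner G e 1) (corner G e (-1)) p q,
          has_dims (compress F' f) (corner G f 1) (corner G f (-1)) p' q' &
          p%:Z - q%:Z = p'%:Z - q'%:Z].
Proof.
move=> ee ff.
(* Replacing v and w by e v f and f w e. *)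
wlog [ev vf fw we] : v w / [/\ e *m v = v, v *m f = v, f *m w = w & w *m e = w].
  move=> H vw wv; apply: (H (e *m v *m f) (f *m w *m e)).
  - by split; [rewrite !mulmxA ee|rewrite -mulmxA ff|rewrite !mulmxA ff|
      rewrite -mulmxA ee].
  - have -> : e *m v *m f *m (f *m w *m e) = e *m (v *m (f *m f) *m w) *m e.
      by rewrite !mulmxA.
    by rewrite ff -wv -!mulmxA (mulmxA v w) vw (mulmxA v w) vw !ee.
  - have -> : f *m w *m e *m (e *m v *m f) = f *m (w *m (e *m e) *m v) *m f.
      by rewrite !mulmxA.
    by rewrite ee -vw -!mulmxA (mulmxA w v) wv (mulmxA w v) wv !ff.
move=> vw wv.
have [delta0 d0 par] := compress_parametrix F ee.
have be := bdd_amp (G := G) e; have [le [c [c0 ec]]] := be.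
have c1 : 0 < c + 1 by rewrite ltr_wpDl.
have [lv _] := bdd_amp (G := G) v; have [lw _] := bdd_amp (G := G) w.
exists (delta0 / (c + 1)); first by rewrite divr_gt0.
move=> F' FF'.
have ss1 : 1 * 1 = 1 :> R[i] by rewrite mulr1.
have ssN : (-1) * (-1) = 1 :> R[i] by rewrite mulrNN mulr1.
have mT := compress_map F 1 ee; have mS := compress_map F (-1) ee.
rewrite opprK in mS.
have [bF bF'] := (bdd_amp_op F n, bdd_amp_op F' n).
pose U x := amp G v (amp_op F' m (amp G w x)).
have eU x : amp G e (U x) = U x by rewrite /U -ampM ev.
have gU x : U (gam x) = - gam (U x).
  by rewrite /U amp_gam amp_op_gam (linN lv) amp_gam.
have bU : bdd_lin U.
  exact: (bdd_lin_comp (bdd_lin_comp (bdd_amp w) (bdd_amp_op F' m)) (bdd_amp v)).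
have mU := corner_map (e := e) 1 bU.1 eU gU.
have P0 s : s * s = 1 ->
  (exists d, has_dims (compress F e \o compress F e) (corner G e s) (corner G e s) d d).
  move=> ss; suff [] : (exists d, has_dims (compress F e \o compress F e)
      (corner G e s) (corner G e s) d d) /\
    (exists d, has_dims (compress F e \o compress F e)
      (corner G e s) (corner G e s) d d) by [].
  apply: (par _ (fun x => amp G e (amp_op F n (amp G e x) -
    amp G e (amp_op F n x))) (fun=> 0)) => //.
  - exact: bdd_lin0.
  - by move=> x; rewrite nrm0 mulr_ge0 ?nrm_ge0// ltW.
  - exact: (cpt_lin_compl (amp_op_comm F e) be).
  - by move=> x; rewrite /compress -ampM ee.
  - by move=> x; rewrite /compress amp_gam amp_op_gam (linN le) amp_gam.
  - by move=> x; rewrite (linB le) -ampM ee add0r addrC subrK.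
have PU : forall s, s * s = 1 ->
    (exists d, has_dims (compress F e \o U) (corner G e s)
      (corner G e s) d d) /\
    (exists d, has_dims (U \o compress F e) (corner G e s) (corner G e s) d d).
  apply: (par _ (fun x => amp G v (amp_op F' m (amp G w x) -
    amp G w (amp_op F' n x))) (fun x => amp G e (amp_op F' n x - amp_op F n x))) => //.
  - exact: (bdd_lin_comp (bdd_linB bF' bF) be).
  - move=> x; apply: le_trans (ec _) _.
    have -> : delta0 * nrm x = (c + 1) * (delta0 / (c + 1) * nrm x).
      by rewrite mulrA mulrCA mulfV ?gt_eqF// mulr1.
    apply: ler_pM; rewrite ?nrm_ge0 ?lerDl//.
    rewrite !nrm_bpow mulr_sumr; apply: ler_sum => i _.
    have := FF' (bpow_coord i x); rewrite -!amp_opE.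
    by rewrite -(linB (@linear_bpow_coord _ X n i)).
  - exact: (cpt_lin_compl (amp_op_comm F' w) (bdd_amp v)).
  - move=> x; rewrite (linB lv) (linB le) -[in RHS]ampM vw -/(U x).
    by rewrite [X in _ = _ + X]addrC subrKA [RHS]addrC subrK.
have [dT HT] := P0 1 ss1; have [dT' HT'] := P0 (-1) ssN.
have [[dU HU] _] := PU 1 ss1; have [_ [dU' HU']] := PU (-1) ssN.
have sD s := corner_subspace (G := G) e s.
have sD' s := corner_subspace (G := G) f s.
have [p [q [p' [q' [H H' pq]]]]] := index_common_parametrix (sD 1) (sD (-1))
  mT mU mS HT HT' HU HU'.
exists p, q, p', q'; split=> //.
have bw s : linear_bij_on (corner G e s) (corner G f s) (amp G w).
  split=> [|x [ex gx] w0|y [fy gy]].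
  - split; first exact: lin_on.
    move=> x [ex gx]; split; first by rewrite -ampM fw.
    by rewrite -amp_gam gx (linZ lw).
  - by rewrite -ex -vw ampM w0 (lin0 lv).
  - exists (amp G v y); last by rewrite -ampM wv.
    by split; [rewrite -ampM ev|rewrite -amp_gam gy (linZ lv)].
refine (proj1 (has_dims_conj (u := amp G w) (v := amp G w) p' q' (sD 1) (sD (-1))
  (sD' 1) (sD' (-1)) mU (compress_map F' 1 ff) (bw 1) (bw (-1)) _) H').
by move=> x _; rewrite /U /compress -!ampM wv fw.
Qed.

End Compressions.

(** * The index pairing as a function of the module *)

Section ModuleIndex.
Context {R : realType} {A : unitalAlg R[i]}.
Implicit Types M N : fredholm_module A.

(** A chain of relations between two unital modules can pass through modules on
   which 1 acts as a proper idempotent, so the index is attached to every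
   module. *)
Definition module_index M n (e : 'M[A]_n) : int :=
  fredholm_index (compression M e) (corner_even M e) (corner_odd M e).

Definition module_dims M n (e : 'M[A]_n) p q : Prop :=
  has_dims (compression M e) (corner M e 1) (corner M e (-1)) p q.

Lemma compression_map M n (e : 'M[A]_n) s : e *m e = e ->
  linear_map_on (corner M e s) (corner M e (- s)) (compression M e).
Proof. exact: (compress_map (fm_op M)). Qed.

Lemma module_index_local (G : graded_rep A) (F : fredholm_op G) n m
    (e : 'M[A]_n) (f : 'M[A]_m) (v : 'M[A]_(n, m)) (w : 'M[A]_(m, n)) :
  e *m e = e -> f *m f = f -> v *m w = e -> w *m v = f ->
  exists2 delta : R, 0 < delta & forall F' : fredholm_op G,
    (forall x, nrm (F' x - F x) <= delta * nrm x) ->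
    exists p q p' q', [/\ module_dims (FredholmModule F) e p q,
      module_dims (FredholmModule F') f p' q' & p%:Z - q%:Z = p'%:Z - q'%:Z].
Proof. exact: index_compress. Qed.

Lemma module_dims_ex M n (e : 'M[A]_n) : e *m e = e ->
  exists p q, module_dims M e p q.
Proof.
case: M => G F ee; have [delta d0 H] := module_index_local F ee ee ee ee.
have [|p [q [_ [_ [Hpq _ _]]]]] := H F; last by exists p, q.
by move=> x; rewrite subrr nrm0 mulr_ge0 ?nrm_ge0// ltW.
Qed.

Lemma module_indexE M n (e : 'M[A]_n) p q : e *m e = e ->
  module_dims M e p q -> module_index M e = p%:Z - q%:Z.
Proof.
move=> ee [Hp Hq]; rewrite /module_index /fredholm_index.
rewrite corner_evenE// corner_oddE//.
have sD := corner_subspace (G := M) e 1; have mT := compression_map M 1 ee.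
have sk := kernel_subspace sD mT.
rewrite (quotient_dimE (subspace_set0 _) sk (set0_sub sk) Hp).
by rewrite (quotient_dimE (image_subspace sD mT) (corner_subspace e (-1))
  (linear_image_sub mT) Hq).
Qed.

Lemma closed_limits (X : completeNormedModType R[i]) (V : set X) :
  closed_under_limits V -> closed V.
Proof.
move=> cV x clx; apply: cV => e e0.
have e0' : 0 < e%:C%C :> R[i] by rewrite ltcR.
have [y [Vy]] := clx _ (nbhsx_ballx _ _ e0').
by rewrite -ball_normE /ball_/= nrmE ltcR => /ltW; exists y.
Qed.

Lemma corner_closed M n (e : 'M[A]_n) s : closed (corner M e s).
Proof.
have b1 := bdd_linB (bdd_amp (G := M) e) (bdd_lin_id _).
have b2 := bdd_linB (bdd_gam (G := M) n) (bdd_linZ s (bdd_lin_id _)).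
apply: closed_limits => x lx; split; apply/eqP; rewrite -subr_eq0; apply/eqP.
- apply: (closed_kernel b1) => e0 /lx[v [ev _] xv].
  by exists v => //=; rewrite ev subrr.
- apply: (closed_kernel b2) => e0 /lx[v [_ gv] xv].
  by exists v => //=; rewrite gv subrr.
Qed.

Lemma compression_fredholm M n (e : 'M[A]_n) : e *m e = e ->
  fredholm_between (compression M e) (corner_even M e) (corner_odd M e).
Proof.
move=> ee; rewrite corner_evenE// corner_oddE//.
have [lT ET] := compression_map M 1 ee.
have [p [q [Hp Hq]]] := module_dims_ex M ee.
split=> //.
- by split; [exact: corner_subspace|exact: corner_closed].
- by split; [exact: corner_subspace|exact: corner_closed].
- have [_ [c [_ cT]]] := bdd_compress (fm_op M) e.
  by exists c%:C%C => x _; rewrite !nrmE -rmorphM/= lecR; exact: cT.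
- by exists p.
- by exists q.
Qed.

(** Let c be the supremum of the t such that g is constant on [0, t]. Then g is
   constant on [0, c], and beyond c unless c = 1. *)
Lemma locally_constant01 (T : Type) (g : R -> T) :
  (forall t, 0 <= t <= 1 -> exists2 d : R, 0 < d &
    forall s, 0 <= s <= 1 -> `|s - t| < d -> g s = g t) -> g 0 = g 1.
Proof.
move=> lc.
pose S : set R := [set t | 0 <= t <= 1 /\ forall s, 0 <= s <= t -> g s = g 0].
have S0 : S 0.
  split=> [|s]; first by rewrite lexx ler01.
  by move=> s0; have -> : s = 0 by apply/eqP; rewrite eq_le andbC.
have ubS : ubound S 1 by move=> t [/andP[]].
have hS : has_sup S by split; [exists 0|exists 1].
have c0 : 0 <= sup S by apply: ub_le_sup S0; exists 1.
have c1 : sup S <= 1 by apply: ge_sup => //; exists 0.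
have [d d0 hd] := lc (sup S) (introT andP (conj c0 c1)).
have [t [/andP[t0 t1] ht] tc] := sup_adherent d0 hS.
have tS : t <= sup S.
  by apply: ub_le_sup; [exists 1|split=> //; rewrite t0].
have gc : g (sup S) = g 0.
  rewrite -(hd t); [|by rewrite t0|by rewrite ltr_norml; apply/andP; split; lra].
  by apply: ht; rewrite t0 lexx.
pose r := Num.min (sup S + d / 2) 1.
have r1 : r <= 1 by rewrite ge_min lexx orbT.
have rc : r <= sup S + d / 2 by rewrite ge_min lexx.
have cr : sup S <= r by rewrite le_min c1 andbT; lra.
have Sr : S r.
  split=> [|s /andP[s0 sr]]; first by rewrite r1 andbT (le_trans c0).
  have [st|ts] := leP s t; first by apply: ht; rewrite s0.
  rewrite -gc; apply: hd; first by rewrite s0 (le_trans sr).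
  by rewrite ltr_norml; apply/andP; split; lra.
have : r <= sup S by apply: ub_le_sup Sr; exists 1.
rewrite /r ge_min => /orP[h|c1']; first by exfalso; lra.
have e1 : sup S = 1 by apply/eqP; rewrite eq_le c1.
by rewrite -gc e1.
Qed.

Lemma module_index_homotopic M N n (e : 'M[A]_n) : e *m e = e ->
  fm_homotopic M N -> module_index M e = module_index N e.
Proof.
move=> ee [G [f [cf -> ->]]].
apply: (locally_constant01 (g := fun t => module_index (FredholmModule (f t)) e)).
move=> t t01; have [delta d0 H] := module_index_local (f t) ee ee ee ee.
have [d d1 hd] := cf t t01 _ d0; exists d => // s s01 st.
have [x|p [q [p' [q' [Hpq Hpq' epq]]]]] := H (f s).
  have := hd s s01 st x; rewrite !nrmE -rmorphM/= lecR.
  by [].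
by rewrite (module_indexE ee Hpq) (module_indexE ee Hpq').
Qed.

(** The compression is its own inverse between the two corners. *)
Lemma module_index_degenerate M n (e : 'M[A]_n) : e *m e = e ->
  fm_degenerate M -> module_index M e = 0.
Proof.
move=> ee [FF Fa].
have Fe x : amp_op (fm_op M) n (amp M e x) = amp M e (amp_op (fm_op M) n x).
  apply: bpowP => i; rewrite amp_opE !opmxE linear_sum.
  by apply: eq_bigr => j _; rewrite amp_opE; exact: Fa.
have TT s x : corner M e s x -> compression M e (compression M e x) = x.
  move=> [ex _]; change (compress (fm_op M) e (compress (fm_op M) e x) = x).
  rewrite /compress !Fe -!ampM !ee.
  rewrite -[RHS]ex; congr (amp _ _ _); apply: bpowP => i.
  by rewrite !amp_opE FF.
have H : module_dims M e 0 0.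
  apply: has_dims_bij; [exact: corner_subspace|exact: corner_subspace|].
  have mT s := compression_map M s ee.
  split=> [|x Dx Tx|y Ey]; first exact: mT.
    rewrite -(TT _ _ Dx) Tx; apply: lin0.
    by have [] := bdd_compress (fm_op M) e.
  exists (compression M e y); last exact: TT Ey.
  by have := (mT (-1)).2 y Ey; rewrite opprK.
by rewrite (module_indexE ee H).
Qed.

(** Isomorphisms of modules and the two projections of a direct sum are of this
   kind. *)
Record intertwines M N (h : gr_space M -> gr_space N) : Prop := Intertwines {
  itw_lin : linear h;
  itw_rep : forall a x, h (gr_rep M a x) = gr_rep N a (h x);
  itw_op : forall x, h (fm_op M x) = fm_op N (h x);
  itw_gamma : forall x, h (gr_gamma M x) = gr_gamma N (h x) }.

Section Intertwine.
Variables (M N : fredholm_module A) (h : gr_space M -> gr_space N).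
Hypothesis ih : intertwines h.

Lemma itw_amp_lin n : linear (@amp_fun _ _ _ n h).
Proof.
move=> k x y; apply: bpowP => i.
rewrite (@linear_bpow_coord _ _ n i) !amp_funE (@linear_bpow_coord _ _ n i).
exact: itw_lin.
Qed.

Lemma itw_amp m n (v : 'M[A]_(m, n)) x :
  amp_fun h (amp M v x) = amp N v (amp_fun h x).
Proof.
apply: bpowP => i; rewrite amp_funE !opmxE.
have lh := itw_lin ih.
rewrite (big_morph h (linD lh) (lin0 lh)); apply: eq_bigr => j _.
by rewrite amp_funE itw_rep.
Qed.

Lemma itw_gam n (x : bpow (gr_space M) n) :
  amp_fun h (amp_fun (gr_gamma M) x) = amp_fun (gr_gamma N) (amp_fun h x).
Proof. by apply: bpowP => i; rewrite !amp_funE itw_gamma. Qed.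

Lemma itw_compression n (e : 'M[A]_n) x :
  amp_fun h (compression M e x) = compression N e (amp_fun h x).
Proof.
rewrite -[compression M e x]/(compress (fm_op M) e x) itw_amp.
rewrite -[RHS]/(compress (fm_op N) e (amp_fun h x)) /compress.
rewrite -[amp N e (amp_fun h x)]itw_amp.
by congr (amp N e _); apply: bpowP => i; rewrite !amp_funE itw_op.
Qed.

Lemma itw_corner n (e : 'M[A]_n) s :
  linear_map_on (corner M e s) (corner N e s) (amp_fun h).
Proof.
split; first by apply: lin_on; exact: itw_amp_lin.
move=> x [ex gx]; split; first by rewrite -itw_amp ex.
by rewrite -itw_gam gx (linZ (@itw_amp_lin n)).
Qed.

End Intertwine.

Lemma module_index_iso M N n (e : 'M[A]_n) : e *m e = e ->
  fm_iso M N -> module_index M e = module_index N e.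
Proof.
move=> ee [u [v [[_ _ uK vK] [ur uF ug]]]].
have iu : intertwines (M := M) (N := N) u.
  by split=> // k x y; rewrite linearP.
have iv : intertwines (M := N) (N := M) v.
  split=> [k x y|a x|x|x]; first by rewrite linearP.
  - by rewrite -{1}[x]vK -ur uK.
  - by rewrite -{1}[x]vK -uF uK.
  - by rewrite -{1}[x]vK -ug uK.
have bu s : linear_bij_on (corner M e s) (corner N e s) (amp_fun u).
  have uv x : amp_fun v (amp_fun u x) = x :> bpow _ n.
    by apply: bpowP => i; rewrite !amp_funE uK.
  have vu x : amp_fun u (amp_fun v x) = x :> bpow _ n.
    by apply: bpowP => i; rewrite !amp_funE vK.
  split=> [|x _ ux|y Ey]; first exact: itw_corner.
    by rewrite -[x]uv ux; apply: lin0; exact: itw_amp_lin.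
  by exists (amp_fun v y); [apply: (itw_corner iv e s).2|exact: vu].
have sD P s := corner_subspace (G := fm_base P) e s.
have mT P := compression_map P 1 ee.
have [p [q H]] := module_dims_ex M ee.
rewrite (module_indexE ee H); symmetry; apply: module_indexE => //.
refine (proj1 (has_dims_conj p q (sD M 1) (sD M (-1)) (sD N 1) (sD N (-1))
  (mT M) (mT N) (bu 1) (bu (-1)) _) H).
by move=> x _; exact: itw_compression.
Qed.

Lemma module_index_sum M N n (e : 'M[A]_n) : e *m e = e ->
  module_index (fm_sum M N) e = module_index M e + module_index N e.
Proof.
move=> ee; have [p [q H]] := module_dims_ex M ee.
have [p' [q' H']] := module_dims_ex N ee.
have i1 : @intertwines (fm_sum M N) M fst by split.
have i2 : @intertwines (fm_sum M N) N snd by split.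
have sD P s := corner_subspace (G := fm_base P) e s.
have mT P := compression_map P 1 ee.
have inj (x y : bpow (gr_space (fm_sum M N)) n) :
    amp_fun fst x = amp_fun fst y -> amp_fun snd x = amp_fun snd y -> x = y.
  move=> xy1 xy2; apply: bpowP => i; apply/pair_eqP/andP; split; apply/eqP.
    by rewrite -!amp_funE xy1.
  by rewrite -!amp_funE xy2.
have inj0 s x : corner (fm_sum M N) e s x -> amp_fun fst x = 0 ->
    amp_fun snd x = 0 -> x = 0.
  move=> _ x1 x2; apply: inj.
    by rewrite x1 (lin0 (@itw_amp_lin _ _ _ i1 n)).
  by rewrite x2 (lin0 (@itw_amp_lin _ _ _ i2 n)).
have surj s x1 x2 : corner M e s x1 -> corner N e s x2 ->
    exists2 x, corner (fm_sum M N) e s x & amp_fun fst x = x1 /\ amp_fun snd x = x2.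
  move=> [e1 g1] [e2 g2].
  pose x : bpow (gr_space (fm_sum M N)) n :=
    [ffun i => (bpow_coord i x1, bpow_coord i x2)].
  have fx : amp_fun fst x = x1.
    by apply: bpowP => i; rewrite amp_funE {1}/bpow_coord ffunE.
  have sx : amp_fun snd x = x2.
    by apply: bpowP => i; rewrite amp_funE {1}/bpow_coord ffunE.
  exists x => //; split; apply: inj.
  - by rewrite (itw_amp i1) fx e1.
  - by rewrite (itw_amp i2) sx e2.
  - by rewrite (itw_gam i1) (linZ (@itw_amp_lin _ _ _ i1 n)) fx g1.
  - by rewrite (itw_gam i2) (linZ (@itw_amp_lin _ _ _ i2 n)) sx g2.
have HS : module_dims (fm_sum M N) e (p + p') (q + q').
  apply: (has_dims_prod (sD _ _) (sD _ _) (sD _ _) (sD _ _) (sD _ _) (sD _ _)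
    (mT (fm_sum M N)) (mT M) (mT N) (itw_corner i1 e 1) (itw_corner i2 e 1)
    (itw_corner i1 e (-1)) (itw_corner i2 e (-1)) _ _ _ _ _ _ H H').
  - exact: inj0.
  - exact: surj.
  - exact: inj0.
  - exact: surj.
  - by move=> x _; exact: itw_compression.
  - by move=> x _; exact: itw_compression.
rewrite (module_indexE ee HS) (module_indexE ee H) (module_indexE ee H').
by rewrite !PoszD opprD addrACA.
Qed.

End ModuleIndex.

(** * The index pairing as a function of the idempotent *)

Section Idempotents.
Context {A : pzRingType}.

(** The rectangular partial identity, which implements padding by
   conjugation. *)
Definition pad_incl n N : 'M[A]_(n, N) := \matrix_(i, j) (i == j :> nat)%:R.

Lemma mulmx_pad_incl p n N (B : 'M[A]_(p, n)) i (j : 'I_N) :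
  (B *m pad_incl n N) i j = if insub (j : nat) is Some k then B i k else 0.
Proof.
rewrite mxE; case: insubP => [k _ kj|jn].
  rewrite (bigD1 k)//= mxE kj eqxx mulr1 big1 ?addr0// => l lk.
  rewrite mxE (_ : (l == j :> nat) = false) ?mulr0//.
  by apply/negbTE; rewrite -kj; exact: lk.
rewrite big1// => k _; rewrite mxE (_ : (k == j :> nat) = false) ?mulr0//.
by apply/negbTE; apply: contra jn => /eqP <-.
Qed.

Lemma pad_incl_mulmx p n N (B : 'M[A]_(n, p)) (i : 'I_N) j :
  (pad_incl N n *m B) i j = if insub (i : nat) is Some k then B k j else 0.
Proof.
rewrite mxE; case: insubP => [k _ ki|iN].
  rewrite (bigD1 k)//= mxE ki eqxx mul1r big1 ?addr0// => l lk.
  rewrite mxE (_ : (i == l :> nat) = false) ?mul0r//.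
  by apply/negbTE; rewrite -ki eq_sym; exact: lk.
rewrite big1// => k _; rewrite mxE (_ : (i == k :> nat) = false) ?mul0r//.
by apply/negbTE; apply: contra iN => /eqP ->.
Qed.

Lemma pad_inclE n N (e : 'M[A]_n) :
  pad_mx N e = pad_incl N n *m e *m pad_incl n N.
Proof.
apply/matrixP => i j; rewrite mulmx_pad_incl mxE.
case: (insub (j : nat)) => [j'|]; first by rewrite pad_incl_mulmx.
by case: (insub (i : nat)).
Qed.

Lemma pad_inclK n N : (n <= N)%N -> pad_incl n N *m pad_incl N n = 1%:M.
Proof.
move=> nN; apply/matrixP => i j; rewrite !mxE.
rewrite (bigD1 (widen_ord nN i))//= !mxE eqxx mul1r big1 ?addr0//.
move=> k ki; rewrite !mxE (_ : (i == k :> nat) = false) ?mul0r//.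
by apply/negbTE; move: ki; apply: contra => /eqP ik; apply/eqP/val_inj.
Qed.

(** Partial identities remove the padding; the extra factor w v in the first
   matrix makes the complementary projections disappear in the products. *)
Lemma idem_equiv_rect (e f : @Defs.idempotent A) : idem_equiv e f ->
  exists (v : 'M[A]_(idem_size e, idem_size f))
         (w : 'M[A]_(idem_size f, idem_size e)),
    v *m w = idem_mx e /\ w *m v = idem_mx f.
Proof.
case: e f => n e ee [m f ff] [N /= [nN mN [v [w []]]]].
rewrite !pad_inclE; set J := pad_incl n N; set J' := pad_incl N n.
set I := pad_incl m N; set I' := pad_incl N m => vw wv.
have JJ : J *m J' = 1%:M by exact: pad_inclK.
have II : I *m I' = 1%:M by exact: pad_inclK.
have wvI : w *m v *m I' *m I = w *m v by rewrite -wv -!mulmxA (mulmxA I I') II mul1mx.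
have Jvw : J' *m J *m (v *m w) = v *m w.
  by rewrite -vw -!mulmxA (mulmxA J J') JJ mul1mx.
have cvw : J *m (v *m w) *m J' = e.
  by rewrite -vw !mulmxA JJ mul1mx -mulmxA JJ mulmx1.
have cwv : I *m (w *m v) *m I' = f.
  by rewrite -wv !mulmxA II mul1mx -mulmxA II mulmx1.
have idvw : v *m w *m (v *m w) = v *m w.
  by rewrite -vw -!mulmxA (mulmxA J J') JJ mul1mx (mulmxA e e) ee.
have idwv : w *m v *m (w *m v) = w *m v.
  by rewrite -wv -!mulmxA (mulmxA I I') II mul1mx (mulmxA f f) ff.
exists (J *m v *m (w *m v) *m I'), (I *m w *m J'); split.
- rewrite -cvw.
  transitivity (J *m v *m (w *m v *m I' *m I) *m w *m J'); first by rewrite !mulmxA.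
  by rewrite wvI -idvw !mulmxA.
- rewrite -cwv.
  transitivity (I *m w *m (J' *m J *m (v *m w)) *m v *m I'); first by rewrite !mulmxA.
  by rewrite Jvw -idwv !mulmxA.
Qed.

End Idempotents.

Section IdempotentIndex.
Context {R : realType} {A : unitalAlg R[i]}.
Implicit Types M : fredholm_module A.

Lemma module_index_equiv M (e f : @Defs.idempotent A) : idem_equiv e f ->
  module_index M (idem_mx e) = module_index M (idem_mx f).
Proof.
move=> /idem_equiv_rect[v [w [vw wv]]]; case: M => G F.
have [delta d0 H] := module_index_local F (idem_mxP e) (idem_mxP f) vw wv.
have [|p [q [p' [q' [Hp Hp' pq]]]]] := H F.
  by move=> x; rewrite subrr nrm0 mulr_ge0 ?nrm_ge0// ltW.
by rewrite (module_indexE (idem_mxP e) Hp) (module_indexE (idem_mxP f) Hp').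
Qed.

Lemma module_index_diag M (e f : @Defs.idempotent A) :
  module_index M (idem_mx (idem_diag e f)) =
  module_index M (idem_mx e) + module_index M (idem_mx f).
Proof.
have gee := idem_mxP (idem_diag e f).
case: e f gee => n e ee [m f ff] /=; set g := block_mx e 0 0 f => gg.
have [p [q H]] := module_dims_ex M ee.
have [p' [q' H']] := module_dims_ex M ff.
pose X := gr_space M.
pose fs (x : bpow X (n + m)) : bpow X n := [ffun i => bpow_coord (lshift m i) x].
pose sn (x : bpow X (n + m)) : bpow X m := [ffun i => bpow_coord (rshift n i) x].
have fsE x i : bpow_coord i (fs x) = bpow_coord (lshift m i) x.
  by rewrite {1}/bpow_coord ffunE.
have snE x i : bpow_coord i (sn x) = bpow_coord (rshift n i) x.
  by rewrite {1}/bpow_coord ffunE.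
have lfs : linear fs.
  move=> k x y; apply: bpowP => i.
  by rewrite (@linear_bpow_coord _ X _ i) !fsE (@linear_bpow_coord _ X _ _).
have lsn : linear sn.
  move=> k x y; apply: bpowP => i.
  by rewrite (@linear_bpow_coord _ X _ i) !snE (@linear_bpow_coord _ X _ _).
have fs_amp x : fs (amp M g x) = amp M e (fs x).
  apply: bpowP => i; rewrite fsE !opmxE big_split_ord/= [X in _ + X]big1 ?addr0.
    by apply: eq_bigr => j _; rewrite block_mxEul fsE.
  by move=> j _; rewrite block_mxEur mxE gr_rep0.
have sn_amp x : sn (amp M g x) = amp M f (sn x).
  apply: bpowP => i; rewrite snE !opmxE big_split_ord/= big1 ?add0r.
    by apply: eq_bigr => j _; rewrite block_mxEdr snE.
  by move=> j _; rewrite block_mxEdl mxE gr_rep0.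
have fs_fun h x : fs (amp_fun h x) = amp_fun h (fs x).
  by apply: bpowP => i; rewrite fsE !amp_funE fsE.
have sn_fun h x : sn (amp_fun h x) = amp_fun h (sn x).
  by apply: bpowP => i; rewrite snE !amp_funE snE.
have inj x y : fs x = fs y -> sn x = sn y -> x = y.
  move=> xy1 xy2; apply: bpowP => i; rewrite -(splitK i).
  by case: (split i) => j /=; rewrite -?fsE -?snE ?xy1 ?xy2.
have inj0 s x : corner M g s x -> fs x = 0 -> sn x = 0 -> x = 0.
  by move=> _ x1 x2; apply: inj; rewrite ?x1 ?x2 ?(lin0 lfs) ?(lin0 lsn).
have mfs s : linear_map_on (corner M g s) (corner M e s) fs.
  split; first exact: lin_on.
  by move=> x [gx hx]; split; rewrite -?fs_amp ?gx// -fs_fun hx (linZ lfs).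
have msn s : linear_map_on (corner M g s) (corner M f s) sn.
  split; first exact: lin_on.
  by move=> x [gx hx]; split; rewrite -?sn_amp ?gx// -sn_fun hx (linZ lsn).
have surj s x1 x2 : corner M e s x1 -> corner M f s x2 ->
    exists2 x, corner M g s x & fs x = x1 /\ sn x = x2.
  move=> [e1 g1] [e2 g2].
  pose x : bpow X (n + m) := [ffun i => match split i with
    | inl j => bpow_coord j x1 | inr j => bpow_coord j x2 end].
  have fx : fs x = x1.
    apply: bpowP => i; rewrite fsE {1}/bpow_coord ffunE.
    by rewrite -[lshift m i]/(unsplit (inl i)) unsplitK.
  have sx : sn x = x2.
    apply: bpowP => i; rewrite snE {1}/bpow_coord ffunE.
    by rewrite -[rshift n i]/(unsplit (inr i)) unsplitK.
  exists x => //; split; apply: inj.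
  - by rewrite fs_amp fx e1.
  - by rewrite sn_amp sx e2.
  - by rewrite fs_fun (linZ lfs) fx g1.
  - by rewrite sn_fun (linZ lsn) sx g2.
have sD k (h : 'M[A]_k) s := corner_subspace (G := fm_base M) h s.
have HS : module_dims M g (p + p') (q + q').
  apply: (has_dims_prod (sD _ _ _) (sD _ _ _) (sD _ _ _) (sD _ _ _) (sD _ _ _)
    (sD _ _ _) (compression_map M 1 gg) (compression_map M 1 ee)
    (compression_map M 1 ff) (mfs 1) (msn 1) (mfs (-1)) (msn (-1))
    _ _ _ _ _ _ H H').
  - exact: inj0.
  - exact: surj.
  - exact: inj0.
  - exact: surj.
  - move=> x _; change (fs (compress (fm_op M) g x) = compress (fm_op M) e (fs x)).
    by rewrite /compress fs_amp fs_fun fs_amp.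
  - move=> x _; change (sn (compress (fm_op M) g x) = compress (fm_op M) f (sn x)).
    by rewrite /compress sn_amp sn_fun sn_amp.
rewrite (module_indexE gg HS) (module_indexE ee H) (module_indexE ff H').
by rewrite !PoszD opprD addrACA.
Qed.

End IdempotentIndex.

Section Words.
Context {T : Type} {V : zmodType}.

Fixpoint word_eval (g : T -> V) (u : abword T) : V :=
  match u with
  | ABgen t => g t
  | ABzero => 0
  | ABadd u v => word_eval g u + word_eval g v
  | ABopp u => - word_eval g u
  end.

Lemma word_eval_abeq (g : T -> V) (rel : abword T -> abword T -> Prop) u v :
  (forall u v, rel u v -> word_eval g u = word_eval g v) ->
  abeq rel u v -> word_eval g u = word_eval g v.
Proof.
move=> grel; elim=> //= {u v}.
- by move=> u v w _ -> _.
- by move=> u u' v v' _ -> _ ->.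
- by move=> u u' _ ->.
- by move=> u v w; rewrite addrA.
- by move=> u v; rewrite addrC.
- by move=> u; rewrite add0r.
- by move=> u; rewrite addNr.
Qed.

Lemma presented_class_eq (rel : abword T -> abword T -> Prop) u v :
  presented_class rel u = presented_class rel v -> abeq rel u v.
Proof.
move=> /(congr1 sval)/= uv; have : abeq rel v v by exact: abeq_refl.
by rewrite -uv.
Qed.

End Words.

Lemma module_index_K0 (R : realType) (A : unitalAlg R[i])
    (M : fredholm_module A) n n' (e : 'M[A]_n) (e' : 'M[A]_n')
    (he : e *m e = e) (he' : e' *m e' = e') :
  K0_class (Idempotent he) = K0_class (Idempotent he') ->
  module_index M e = module_index M e'.
Proof.
move=> /presented_class_eq.
apply: (word_eval_abeq (g := fun f : @Defs.idempotent A => module_index M (idem_mx f))).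
by move=> u v [f f' /module_index_equiv|f f'] //=; rewrite module_index_diag.
Qed.

Lemma module_index_KH (R : realType) (A : unitalAlg R[i])
    (BB : completeNormedModType R[i] -> Prop) (M M' : module_in A BB) n
    (e : 'M[A]_n) : e *m e = e ->
  KH_class M = KH_class M' -> module_index M e = module_index M' e.
Proof.
move=> ee /presented_class_eq.
apply: (word_eval_abeq (g := fun M : module_in A BB => module_index M e)).
move=> u v [N N'|N N'|N N1 N2|N] /=.
- exact: module_index_iso.
- exact: module_index_homotopic.
- by move=> /(module_index_iso ee) ->; exact: module_index_sum.
- exact: module_index_degenerate.
Qed.

Theorem theorem4p2 (R : realType) (A : unitalAlg R[i])
    (BB : completeNormedModType R[i] -> Prop)
    (BB_sum : sum_stable BB) (BB_zero : has_zero_space BB) :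
  (forall (n : nat) (e : 'M[A]_n) (M : fredholm_module A),
     e *m e = e -> fm_unital M ->
     fredholm_between (compression M e) (corner_even M e) (corner_odd M e)) /\
  (forall (n n' : nat) (e : 'M[A]_n) (e' : 'M[A]_n')
     (he : e *m e = e) (he' : e' *m e' = e') (M M' : module_in A BB),
     fm_unital M -> fm_unital M' ->
     K0_class (Idempotent he) = K0_class (Idempotent he') ->
     KH_class M = KH_class M' ->
     fredholm_index (compression M e) (corner_even M e) (corner_odd M e) =
     fredholm_index (compression M' e') (corner_even M' e')
       (corner_odd M' e')).
Proof.
split=> [n e M ee _|n n' e e' he he' M M' _ _ Ke KM].
  exact: compression_fredholm.
rewrite -![fredholm_index _ _ _]/(module_index _ _).
by rewrite (module_index_K0 M Ke) (module_index_KH he' KM).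
Qed.
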